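(* For every electrical network $(G,c)$ with vertex set $V$: (1) The Laplacian $\Delta_{\mathcal H_E}$ is a well-defined, non-negative, closed and Hermitian (symmetric) operator in $\mathcal H_E$. In general it is unbounded and not self-adjoint (that is, there are networks for which it is unbounded and not self-adjoint). (2) The operator $\Delta_2$ in $\ell^2(V)$ is essentially self-adjoint with dense domain, and in general (that is, for some networks) it is unbounded. (3) The Markov operator $P$ is self-adjoint and bounded in $\ell^2(V,c)$. Moreover, the spectrum of $P$ is a subset of $[-1,1]$, and $-I\le P\le I$ on $\ell^2(V,c)$, where $I$ is the identity operator.
   Context: An electrical network $(G,c)$ is a countably infinite, connected, undirected, locally finite graph $G=(V,E)$ without loops and with single edges, together with a symmetric conductance function $c:V\times V\to[0,\infty)$, $c_{xy}=c_{yx}$, with $c_{xy}>0$ if and only if $(xy)\in E$ (written $x\sim y$). The total conductance is $c(x)=\sum_{y\sim x}c_{xy}$. Functions are real-valued. The Laplacian is $(\Delta f)(x)=\sum_{y\sim x}c_{xy}(f(x)-f(y))$, and the Markov operator is $(Pf)(x)=\sum_{y\sim x}p(x,y)f(y)$ with $p(x,y)=c_{xy}/c(x)$. The space $\ell^2(V)$ has inner product $\sum_{x}u(x)v(x)$ and $\ell^2(V,c)$ has inner product $\sum_x c(x)u(x)v(x)$. The energy form is $\mathcal E(u,v)=\frac12\sum_{x,y\in V}c_{xy}(u(x)-u(y))(v(x)-v(y))$, and the finite energy Hilbert space $\mathcal H_E$ is the space of functions $u$ with $\mathcal E(u,u)<\infty$ modulo constants (completed), with inner product $\mathcal E(u,v)$.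 $\delta_x$ is the Kronecker delta function at $x$. For a fixed vertex $o$, the dipole $v_x\in\mathcal H_E$ is the unique element with $\langle v_x,u\rangle_{\mathcal H_E}=u(x)-u(o)$ for all $u\in\mathcal H_E$; one has $\Delta v_x=\delta_x-\delta_o$, and $\mathrm{span}\{v_x\}$ is dense in $\mathcal H_E$. $\Delta_2$ is the closure in $\ell^2(V)$ of $\Delta$ with domain $\mathrm{span}\{\delta_x:x\in V\}$ (finite linear combinations). $\Delta_{\mathcal H_E}$ is the closure in $\mathcal H_E$ of $\Delta$ with domain $\mathrm{span}\{v_x:x\in V\}$. A densely defined symmetric operator is essentially self-adjoint if its closure is self-adjoint. *)

(* Defs.v *)
From HB Require Import structures.
From mathcomp Require Import all_boot all_order all_algebra.
From mathcomp Require Import all_classical all_reals all_analysis.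
From mathcomp Require Import complex finmap ring lra.

Set Implicit Arguments.
Unset Strict Implicit.
Unset Printing Implicit Defensive.

Import Order.TTheory GRing.Theory Num.Theory numFieldNormedType.Exports.

Local Open Scope classical_set_scope.
Local Open Scope ring_scope.
Local Open Scope quotient_scope.

HB.mixin Record NormedModule_hasInner (R : realType) H & NormedModule R H := {
  inner : H -> H -> R;
  innerC : forall u v, inner u v = inner v u;
  innerDl : forall u v w, inner (u + v) w = inner u w + inner v w;
  innerZl : forall a u v, inner (a *: u) v = a * inner u v;
  inner_normE : forall u, inner u u = `|u| ^+ 2
}.

#[short(type="hilbertType")]
HB.structure Definition Hilbert (R : realType) :=
  {H of CompleteNormedModule R H & NormedModule_hasInner R H}.

(* [inner_complete] says that Cauchy filters converge for the distance given
   by [inner]. *)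
HB.factory Record Lmodule_isHilbert (R : realType) H & GRing.Lmodule R H := {
  inner : H -> H -> R;
  innerC : forall u v, inner u v = inner v u;
  innerDl : forall u v w, inner (u + v) w = inner u w + inner v w;
  innerZl : forall a u v, inner (a *: u) v = a * inner u v;
  inner_ge0 : forall u, 0 <= inner u u;
  inner_eq0 : forall u, inner u u = 0 -> u = 0;
  inner_complete : forall F : set_system H, ProperFilter F ->
    (forall e, 0 < e ->
      exists2 A, F A & forall u v, A u -> A v -> inner (u - v) (u - v) <= e) ->
    exists l, forall e, 0 < e -> F [set u | inner (u - l) (u - l) <= e]
}.

HB.builders Context R H & Lmodule_isHilbert R H.

Let innerDr u v w : inner w (u + v) = inner w u + inner w v.
Proof. by rewrite ![inner w _]innerC innerDl. Qed.

Let innerZr a u v : inner v (a *: u) = a * inner v u.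
Proof. by rewrite ![inner v _]innerC innerZl. Qed.

Let norm u := Num.sqrt (inner u u).

Let normE u : norm u ^+ 2 = inner u u.
Proof. by rewrite sqr_sqrtr// inner_ge0. Qed.

Let cauchy_schwarz u v : inner u v <= norm u * norm v.
Proof.
have [v0|v0] := eqVneq (norm v) 0.
  have -> : v = 0 by apply: inner_eq0; rewrite -normE v0 expr0n.
  by rewrite -(scale0r 0) innerZr mul0r mulr_ge0// sqrtr_ge0.
have [u0|u0] := eqVneq (norm u) 0.
  have -> : u = 0 by apply: inner_eq0; rewrite -normE u0 expr0n.
  by rewrite -(scale0r 0) innerZl mul0r mulr_ge0// sqrtr_ge0.
have up : 0 < norm u by rewrite lt_def u0 sqrtr_ge0.
have vp : 0 < norm v by rewrite lt_def v0 sqrtr_ge0.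
have := inner_ge0 ((norm v) *: u + (- norm u) *: v).
rewrite !(innerDl, innerDr, innerZl, innerZr) (innerC v u) -!normE => h.
have : 0 <= (2 * (norm u * norm v)) * (norm u * norm v - inner u v).
  by apply: le_trans h _; rewrite le_eqVlt; apply/orP; left; apply/eqP; ring.
by rewrite pmulr_rge0 ?subr_ge0// mulr_gt0// mulr_gt0.
Qed.

Let normD x y : norm (x + y) <= norm x + norm y.
Proof.
rewrite -(@ler_pXn2r _ 2)// ?nnegrE ?addr_ge0 ?sqrtr_ge0// normE.
rewrite !(innerDl, innerDr) (innerC y x) sqrrD !normE.
have := cauchy_schwarz x y; lra.
Qed.

Let normZ (l : R) x : norm (l *: x) = `|l| * norm x.
Proof.
by rewrite /norm innerZl innerZr mulrA -expr2 sqrtrM ?sqr_ge0// sqrtr_sqr.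
Qed.

Let norm0_eq0 x : norm x = 0 -> x = 0.
Proof. by move=> x0; apply: inner_eq0; rewrite -normE x0 expr0n. Qed.

HB.instance Definition _ := Lmodule_isNormed.Build R H normD normZ norm0_eq0.

Let complete (F : set_system H) : ProperFilter F -> cauchy F -> cvg F.
Proof.
move=> FF Fc.
have [|l Fl] := @inner_complete F FF.
  move=> e e0; have s0 : 0 < Num.sqrt e by rewrite sqrtr_gt0.
  have /cauchyP/(_ (Num.sqrt e / 2)) [|x Fx] := Fc.
    by rewrite divr_gt0.
  exists (ball x (Num.sqrt e / 2)) => // u v xu xv.
  rewrite -normE -[e](sqr_sqrtr (ltW e0)) ler_pXn2r ?nnegrE ?sqrtr_ge0//.
  have := ball_splitr xu xv.
  by rewrite -ball_normE /= => /ltW.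
apply/cvg_ex; exists l; apply/cvgrPdist_le => e e0.
have := Fl (e ^+ 2) (exprn_gt0 _ e0); apply: filterS => u /=.
by rewrite -normE ler_pXn2r ?nnegrE ?sqrtr_ge0 ?(ltW e0)// distrC.
Qed.

HB.instance Definition _ := Uniform_isComplete.Build H complete.

HB.instance Definition _ :=
  NormedModule_hasInner.Build R H innerC innerDl innerZl
    (fun u => esym (normE u)).

HB.end.

Section sums.
Context {R : realType} {I : choiceType}.
Implicit Types f g : I -> R.

Definition abs_summable f := summable [set: I] (EFin \o f).

(* Sum of an absolutely summable real family over an arbitrary index type. *)
Definition ssum f : R :=
  fine (\esum_(i in [set: I]) (f^\+ i)%:E) -
  fine (\esum_(i in [set: I]) (f^\- i)%:E).

Lemma abs_summable_dom f g : (forall i, `|f i| <= g i) ->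
  abs_summable g -> abs_summable f.
Proof.
move=> fg; apply: le_lt_trans; apply: le_esum => i _ /=.
by rewrite lee_fin (le_trans (fg i))// ler_norm.
Qed.

Lemma abs_summableD f g : abs_summable f -> abs_summable g ->
  abs_summable (fun i => f i + g i).
Proof. exact: summableD. Qed.

Lemma esumZ a f : 0 <= a -> (forall i, 0 <= f i) ->
  (\esum_(i in [set: I]) (a * f i)%:E = a%:E * \esum_(i in [set: I]) (f i)%:E)%E.
Proof.
move=> a0 f0; rewrite /esum -ereal_supZl//; last first.
  by apply/set0P; exists (\sum_(i \in set0) (f i)%:E)%E; exists set0 => //; split.
have scale A : (\sum_(i \in A) (a * f i)%:E = a%:E * \sum_(i \in A) (f i)%:E)%E.
  by rewrite ge0_mule_fsumr// => i; rewrite lee_fin.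
congr ereal_sup; apply/seteqP; split => x /=.
  move=> [A Aok <-]; exists (\sum_(i \in A) (f i)%:E)%E; first by exists A.
  by rewrite scale.
by move=> [_ [A Aok <-] <-]; exists A => //; rewrite scale.
Qed.

Lemma abs_summableZ a f : abs_summable f -> abs_summable (fun i => a * f i).
Proof.
rewrite /abs_summable /summable => fs; under eq_esum do rewrite /= normrM.
by rewrite esumZ// lte_mul_pinfty// lee_fin.
Qed.

Lemma abs_summable_norm f : abs_summable f -> abs_summable (fun i => `|f i|).
Proof.
by apply: le_lt_trans; apply: le_esum => i _ /=; rewrite lee_fin normr_id.
Qed.

Lemma abs_summableN f : abs_summable f -> abs_summable (fun i => - f i).
Proof.
move=> fs; apply: (@abs_summable_dom _ (fun i => `|f i|)) => [i|].
  by rewrite normrN.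
exact: abs_summable_norm.
Qed.

Lemma abs_summable0 : abs_summable (fun=> 0).
Proof. by rewrite /abs_summable /summable esum1 => [|i _] /=; rewrite ?normr0// ltry. Qed.

Let nsum f : R := fine (\esum_(i in [set: I]) (f i)%:E).

Let abs_summable_fin f : (forall i, 0 <= f i) -> abs_summable f ->
  (\esum_(i in [set: I]) (f i)%:E = (nsum f)%:E)%E.
Proof.
move=> f0; rewrite /abs_summable summableE => fs; rewrite fineK//.
by move: fs; under eq_esum do rewrite /= ger0_norm ?f0//.
Qed.

Let nsumD f g : (forall i, 0 <= f i) -> (forall i, 0 <= g i) ->
  abs_summable f -> abs_summable g -> nsum (fun i => f i + g i) = nsum f + nsum g.
Proof.
move=> f0 g0 fs gs; apply: EFin_inj.
rewrite EFinD -(abs_summable_fin f0 fs) -(abs_summable_fin g0 gs).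
have fg0 i : 0 <= f i + g i by rewrite addr_ge0.
rewrite -(abs_summable_fin fg0 (abs_summableD fs gs)).
by rewrite -esumD// => i _; rewrite lee_fin.
Qed.

Let posneg f i : f i = f^\+ i - f^\- i.
Proof. by rewrite -[in LHS](funrposBneg f). Qed.

Let posS f : abs_summable f -> abs_summable f^\+.
Proof.
move=> fs; apply: (@abs_summable_dom _ (fun i => `|f i|)) => [i|].
  by rewrite ger0_norm ?funrpos_ge0// /funrpos ge_max ler_norm normr_ge0.
exact: abs_summable_norm.
Qed.

Let negS f : abs_summable f -> abs_summable f^\-.
Proof.
move=> fs; apply: (@abs_summable_dom _ (fun i => `|f i|)) => [i|].
  by rewrite ger0_norm ?funrneg_ge0// /funrneg ge_max -[X in _ <= X]normrN ler_norm normr_ge0.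
exact: abs_summable_norm.
Qed.

Let ssum_diff f a b : (forall i, 0 <= a i) -> (forall i, 0 <= b i) ->
  abs_summable a -> abs_summable b -> (forall i, f i = a i - b i) ->
  ssum f = nsum a - nsum b.
Proof.
move=> a0 b0 sa sb fab.
have sf : abs_summable f.
  rewrite (_ : f = fun i => a i + - b i); last exact/funext.
  by apply: abs_summableD => //; exact: abs_summableN.
rewrite /ssum -/(nsum _) -/(nsum _).
have : nsum f^\+ + nsum b = nsum f^\- + nsum a.
  rewrite -!nsumD//; [|exact: negS|exact: posS].
  congr nsum; apply/funext => i.
  have := posneg f i.
  by rewrite fab; lra.
lra.
Qed.

Lemma ssumE f : (forall i, 0 <= f i) -> ssum f = fine (\esum_(i in [set: I]) (f i)%:E).
Proof.
move=> f0; rewrite /ssum.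
rewrite (_ : f^\+ = f); last by apply/funext => i; rewrite /funrpos max_l.
rewrite [X in _ - fine X]esum1 ?subr0// => i _.
by rewrite /funrneg max_r// oppr_le0.
Qed.

Lemma ssumD f g : abs_summable f -> abs_summable g ->
  ssum (fun i => f i + g i) = ssum f + ssum g.
Proof.
move=> fs gs.
rewrite (@ssum_diff _ (fun i => f^\+ i + g^\+ i) (fun i => f^\- i + g^\- i)).
- rewrite !nsumD//; [|exact: negS|exact: negS|exact: posS|exact: posS].
  by rewrite /ssum /nsum; lra.
- by move=> i; rewrite addr_ge0.
- by move=> i; rewrite addr_ge0.
- by apply: abs_summableD; exact: posS.
- by apply: abs_summableD; exact: negS.
- move=> i; rewrite (posneg f) (posneg g) /=; lra.
Qed.

Let nsumZ a f : 0 <= a -> (forall i, 0 <= f i) -> abs_summable f ->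
  nsum (fun i => a * f i) = a * nsum f.
Proof.
move=> a0 f0 fs; apply: EFin_inj; rewrite EFinM -(abs_summable_fin f0 fs).
have af0 i : 0 <= a * f i by rewrite mulr_ge0.
by rewrite -(abs_summable_fin af0 (abs_summableZ a fs)) esumZ.
Qed.

Lemma ssumZ a f : abs_summable f -> ssum (fun i => a * f i) = a * ssum f.
Proof.
move=> fs; have [a0|a0] := leP 0 a.
  rewrite (@ssum_diff _ (fun i => a * f^\+ i) (fun i => a * f^\- i)).
  - rewrite !nsumZ//; [|exact: negS|exact: posS].
    by rewrite /ssum /nsum; lra.
  - by move=> i; rewrite mulr_ge0.
  - by move=> i; rewrite mulr_ge0.
  - by apply: abs_summableZ; exact: posS.
  - by apply: abs_summableZ; exact: negS.
  - move=> i; rewrite (posneg f) /=; lra.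
have a0' : 0 <= - a by rewrite oppr_ge0 ltW.
rewrite (@ssum_diff _ (fun i => - a * f^\- i) (fun i => - a * f^\+ i)).
- rewrite !nsumZ//; [|exact: posS|exact: negS].
  by rewrite /ssum /nsum; lra.
- by move=> i; rewrite mulr_ge0.
- by move=> i; rewrite mulr_ge0.
- by apply: abs_summableZ; exact: negS.
- by apply: abs_summableZ; exact: posS.
- move=> i; rewrite (posneg f) /=; lra.
Qed.

Lemma ssum_ge0 f : (forall i, 0 <= f i) -> 0 <= ssum f.
Proof.
by move=> f0; rewrite ssumE// fine_ge0// esum_ge0// => i _; rewrite lee_fin.
Qed.

Lemma ssum_ge f (J : {fset I}) : (forall i, 0 <= f i) -> abs_summable f ->
  \sum_(i <- J) f i <= ssum f.
Proof.
move=> f0 fs; rewrite ssumE// -/(nsum _) -lee_fin -abs_summable_fin//.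
apply: ereal_sup_ubound; exists [set` J]; first by split.
by rewrite fsbig_finite//= set_fsetK sumEFin.
Qed.

Lemma ssum_ge1 f i : (forall i, 0 <= f i) -> abs_summable f -> f i <= ssum f.
Proof. by move=> f0 fs; have := ssum_ge [fset i]%fset f0 fs; rewrite big_seq_fset1. Qed.

Lemma ssum_le f M : (forall i, 0 <= f i) ->
  (forall J : {fset I}, \sum_(i <- J) f i <= M) ->
  abs_summable f /\ ssum f <= M.
Proof.
move=> f0 fM.
have le : (\esum_(i in [set: I]) (f i)%:E <= M%:E)%E.
  apply: ge_ereal_sup => _ /= [A [Af _] <-].
  by rewrite fsbig_finite// sumEFin lee_fin.
have fs : abs_summable f.
  rewrite /abs_summable /summable; under eq_esum do rewrite /= ger0_norm//.
  exact: le_lt_trans le (ltry _).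
by split=> //; rewrite ssumE// -/(nsum _) -lee_fin -abs_summable_fin.
Qed.

Lemma abs_summable_finite f (A : set I) : finite_set A ->
  (forall i, ~ A i -> f i = 0) -> abs_summable f.
Proof.
move=> Af f0; rewrite /abs_summable /summable (esumID A)// setTI setTI.
rewrite [X in (_ + X)%E]esum1 => [|i /f0 /= ->]; last by rewrite normr0.
rewrite adde0 esum_fset// fsbig_finite//= sumEFin; exact: ltry.
Qed.

End sums.

Section weighted.
Context {R : realType} {I : choiceType}.
Variable w : I -> R.
Hypothesis w_ge0 : forall i, 0 <= w i.
Implicit Types u v : I -> R.

Definition sq_summable u := abs_summable (fun i => w i * u i ^+ 2).

Definition wdot u v := ssum (fun i => w i * u i * v i).

Lemma sq_summable_cross u v : sq_summable u -> sq_summable v ->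
  abs_summable (fun i => w i * u i * v i).
Proof.
move=> us vs; apply: abs_summable_dom (abs_summableD us vs) => i.
rewrite /= -mulrDr -(mulrA (w i)) normrM (ger0_norm (w_ge0 i)).
rewrite ler_wpM2l// ler_norml.
have := sqr_ge0 (u i - v i); have := sqr_ge0 (u i + v i).
have := sqr_ge0 (u i); have := sqr_ge0 (v i).
by rewrite sqrrD sqrrB => ? ? ? ?; apply/andP; split; lra.
Qed.

Lemma sq_summableD u v : sq_summable u -> sq_summable v ->
  sq_summable (fun i => u i + v i).
Proof.
move=> us vs.
apply: abs_summable_dom (abs_summableZ 2 (abs_summableD us vs)) => i.
rewrite /= -mulrDr (mulrCA 2) normrM (ger0_norm (w_ge0 i)) ler_wpM2l// ler_norml.
have := sqr_ge0 (u i - v i); have := sqr_ge0 (u i + v i).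
have := sqr_ge0 (u i); have := sqr_ge0 (v i).
by rewrite sqrrD sqrrB => ? ? ? ?; apply/andP; split; lra.
Qed.

Lemma sq_summableZ a u : sq_summable u -> sq_summable (fun i => a * u i).
Proof.
move=> us; rewrite /sq_summable (_ : (fun _ => _) =
  fun i => a ^+ 2 * (w i * u i ^+ 2)); first exact: abs_summableZ.
by apply/funext => i; ring.
Qed.

Lemma sq_summable0 : sq_summable (fun=> 0).
Proof.
rewrite /sq_summable (_ : (fun _ => _) = fun=> 0); first exact: abs_summable0.
by apply/funext => i; ring.
Qed.

Lemma sq_summableB u v : sq_summable u -> sq_summable v ->
  sq_summable (fun i => u i - v i).
Proof.
move=> us vs; rewrite (_ : (fun _ => _) = (fun i => u i + (-1) * v i)).
  by apply: sq_summableD => //; exact: sq_summableZ.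
by apply/funext => i; ring.
Qed.

Lemma wdotC u v : wdot u v = wdot v u.
Proof. by congr ssum; apply/funext => i; rewrite mulrAC. Qed.

Lemma wdotDl u v z : sq_summable u -> sq_summable v -> sq_summable z ->
  wdot (fun i => u i + v i) z = wdot u z + wdot v z.
Proof.
move=> us vs zs; rewrite -ssumD; [|exact: sq_summable_cross..].
by congr ssum; apply/funext => i; ring.
Qed.

Lemma wdotZl a u v : sq_summable u -> sq_summable v ->
  wdot (fun i => a * u i) v = a * wdot u v.
Proof.
move=> us vs; rewrite -ssumZ; last exact: sq_summable_cross.
by congr ssum; apply/funext => i; ring.
Qed.

Lemma wdotE u : wdot u u = ssum (fun i => w i * u i ^+ 2).
Proof. by congr ssum; apply/funext => i; ring. Qed.

Let sq_ge0 u i : 0 <= w i * u i ^+ 2.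
Proof. by rewrite mulr_ge0// sqr_ge0. Qed.

Lemma wdot_ge0 u : 0 <= wdot u u.
Proof. by rewrite wdotE; apply: ssum_ge0 => i; exact: sq_ge0. Qed.

Lemma wdot_ge1 u i : sq_summable u -> w i * u i ^+ 2 <= wdot u u.
Proof. by move=> us; rewrite wdotE; exact: (ssum_ge1 (f := fun i => w i * u i ^+ 2)). Qed.

Lemma wdot_eq0 u i : sq_summable u -> wdot u u = 0 -> 0 < w i -> u i = 0.
Proof.
move=> us u0 wi; have := wdot_ge1 i us; rewrite u0 pmulr_rle0// => h.
by apply/eqP; rewrite -sqrf_eq0 eq_le h sqr_ge0.
Qed.

Lemma sq_summable_finite u (A : set I) : finite_set A ->
  (forall i, ~ A i -> u i = 0) -> sq_summable u.
Proof.
by move=> Af u0; apply: abs_summable_finite Af _ => i /u0 ->; rewrite expr0n mulr0.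
Qed.

Lemma wdot_complete (X : Type) (F : set_system X) (phi : X -> I -> R)
    (l : I -> R) : ProperFilter F ->
  (forall x, sq_summable (phi x)) ->
  (forall i, phi x i @[x --> F] --> l i) ->
  (forall e, 0 < e -> exists2 A, F A & forall x y, A x -> A y ->
     wdot (fun i => phi x i - phi y i) (fun i => phi x i - phi y i) <= e) ->
  sq_summable l /\ forall e, 0 < e -> F [set x |
     wdot (fun i => phi x i - l i) (fun i => phi x i - l i) <= e].
Proof.
move=> FF phis phil Fc.
have key e : 0 < e -> exists2 A, F A & forall x, A x ->
    sq_summable (fun i => phi x i - l i) /\
    wdot (fun i => phi x i - l i) (fun i => phi x i - l i) <= e.
  move=> /Fc[A FA Ae]; exists A => // x Ax; rewrite wdotE.
  apply: ssum_le => [i|J]; first by rewrite mulr_ge0// sqr_ge0.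
  have cvgJ : (\sum_(i <- J) w i * (phi x i - phi y i) ^+ 2) @[y --> F] -->
      \sum_(i <- J) w i * (phi x i - l i) ^+ 2.
    apply: cvg_big => [|i _]; first exact: add_continuous.
    apply: cvgMr; apply: cvgM; apply: cvgB => //; exact: cvg_cst.
  apply: (@closed_cvg _ _ F _ _ _ (@closed_le _ e) _ _ cvgJ).
  apply: filterS FA => y Ay.
  apply: le_trans (Ae x y Ax Ay); rewrite wdotE.
  apply: ssum_ge; last exact: sq_summableB.
  by move=> i; rewrite mulr_ge0// sqr_ge0.
split.
  have [A FA AP] := key 1 ltr01; have [x Ax] := filter_ex FA.
  have [s1 _] := AP x Ax.
  rewrite (_ : l = fun i => phi x i - (phi x i - l i)); last first.
    by apply/funext => i; ring.
  exact: sq_summableB.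
move=> e /key[A FA AP]; apply: filterS FA => x /AP[].
by [].
Qed.

End weighted.

Lemma cvg_small_osc (R : realType) (X : Type) (F : set_system X) (f : X -> R) :
  ProperFilter F ->
  (forall e, 0 < e -> exists2 A, F A & forall x y, A x -> A y -> `|f x - f y| <= e) ->
  cvg (f x @[x --> F]).
Proof.
move=> FF h; apply/cauchy_cvgP/cauchy_ballP => e e0.
have e20 : 0 < e / 2 by rewrite divr_gt0.
have [A FA Ae] := h _ e20.
exists (f @` A, f @` A).
  split; rewrite /nbhs/=; apply: filterS FA => x Ax; by exists x.
move=> [_ _] /= [[x Ax <-] [y Ay <-]].
rewrite -ball_normE /=; apply: le_lt_trans (Ae _ _ Ax Ay) _.
by rewrite ltr_pdivrMr// ltr_pMr// ltr1n.
Qed.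

Section hilbert_theory.
Context {R : realType} {H : hilbertType R}.
Implicit Types u v w : H.

Lemma innerDr u v w : inner w (u + v) = inner w u + inner w v.
Proof. by rewrite ![inner w _]innerC innerDl. Qed.

Lemma innerZr a u v : inner v (a *: u) = a * inner v u.
Proof. by rewrite ![inner v _]innerC innerZl. Qed.

Lemma innerBl u v w : inner (u - v) w = inner u w - inner v w.
Proof. by rewrite -(scaleN1r v) innerDl innerZl mulN1r. Qed.

Lemma inner_ge0 u : 0 <= inner u u.
Proof. by rewrite inner_normE sqr_ge0. Qed.

Lemma inner_eq0 u : inner u u = 0 -> u = 0.
Proof. by rewrite inner_normE => /eqP; rewrite sqrf_eq0 normr_eq0 => /eqP. Qed.

Lemma cauchy_schwarz u v : `|inner u v| <= `|u| * `|v|.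
Proof.
have [->|v0] := eqVneq v 0.
  by rewrite normr0 mulr0 -(scale0r 0) innerZr mul0r normr0.
have vp : 0 < `|v| by rewrite normr_gt0.
rewrite -(@ler_pXn2r _ 2)// ?nnegrE ?mulr_ge0// real_normK ?num_real//.
have := inner_ge0 (`|v| ^+ 2 *: u - inner u v *: v).
rewrite -scaleNr !(innerDl, innerDr, innerZl, innerZr) (innerC v u) !inner_normE.
move=> h; rewrite exprMn -subr_ge0 -(pmulr_rge0 _ (exprn_gt0 2 vp)).
by apply: le_trans h _; rewrite le_eqVlt; apply/orP; left; apply/eqP; ring.
Qed.

Lemma riesz (L : H -> R) (M : R) :
  (forall u v, L (u + v) = L u + L v) ->
  (forall a u, L (a *: u) = a * L u) ->
  (forall u, `|L u| <= M * `|u|) ->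
  exists! v, forall u, inner v u = L u.
Proof.
move=> LD LZ LM.
pose J v := inner v v - 2 * L v.
have Jlb : has_lbound (range J).
  exists (- M ^+ 2) => _ [v _ <-]; rewrite /J inner_normE.
  have := LM v; rewrite ler_norml => /andP[_ h].
  by have := sqr_ge0 (`|v| - M); rewrite sqrrB; lra.
have Jinf : has_inf (range J) by split=> //; exists (J 0), 0.
pose m := inf (range J).
have Jm v : m <= J v by apply: ge_inf => //; exists v.
pose A e := [set v | J v <= m + e].
have AS e d : e <= d -> A e `<=` A d.
  by move=> ed v /= /le_trans; apply; rewrite lerD2l.
pose F := filter_from [set e : R | 0 < e] A.
have FF : ProperFilter F.
  apply: filter_from_proper; first apply: filter_from_filter.
  - by exists 1 => /=.
  - move=> i j /= i0 j0; exists (Num.min i j); first by rewrite /= lt_min i0.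
    by move=> v Av; split; apply: AS Av; rewrite ge_min lexx ?orbT.
  - move=> e /= e0; have [_ [v _ <-] h] := inf_adherent e0 Jinf.
    by exists v; rewrite /A /= ltW.
have Adist e u v : A e u -> A e v -> `|u - v| ^+ 2 <= 4 * e.
  rewrite /A /= => Au Av; have := Jm (2^-1 *: (u + v)).
  rewrite /J LZ LD -!inner_normE innerZl innerZr -(scaleN1r v).
  rewrite !(innerDl, innerDr, innerZl, innerZr) (innerC v u).
  move: Au Av; rewrite /J; lra.
have : cvg F.
  apply/cauchy_cvgP/cauchy_ballP => e e0.
  exists (A (e ^+ 2 / 8), A (e ^+ 2 / 8)).
    by split; exists (e ^+ 2 / 8) => //=; rewrite divr_gt0 ?exprn_gt0.
  move=> [u v] /= [Au Av]; rewrite -ball_normE /=.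
  rewrite -(@ltr_pXn2r _ 2)// ?nnegrE ?(ltW e0)//.
  apply: le_lt_trans (Adist _ _ _ Au Av) _.
  by have := exprn_gt0 2 e0; lra.
move=> /cvg_ex[v Fv]; exists v.
have Lv u : inner v u = L u.
  have [->|u0] := eqVneq u 0.
    by rewrite -(scale0r 0) innerZr LZ !mul0r.
  have up : 0 < `|u| by rewrite normr_gt0.
  apply/eqP; rewrite -subr_eq0 -normr_le0; apply/ler_addgt0Pr => e e0; rewrite add0r.
  pose d := e / (2 * `|u|).
  have d0 : 0 < d by rewrite divr_gt0 // mulr_gt0.
  have Fd : F [set w | `|v - w| <= d].
    apply: Fv; apply/nbhs_ballP; exists d => //= w.
    by rewrite -ball_normE /= => /ltW.
  have FA : F (A (d ^+ 2)) by exists (d ^+ 2); rewrite //= exprn_gt0.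
  have [w [/= wv Aw]] := filter_ex (filterI Fd FA).
  have -> : inner v u - L u = inner (v - w) u + (inner w u - L u).
    by rewrite innerBl; ring.
  apply: le_trans (ler_normD _ _) _.
  have -> : e = d * `|u| + d * `|u|.
    by rewrite /d; field; rewrite gt_eqF.
  clearbody d.
  apply: lerD.
    by apply: le_trans (cauchy_schwarz _ _) _; rewrite ler_wpM2r.
  rewrite -(@ler_pXn2r _ 2)// ?nnegrE ?mulr_ge0 ?(ltW d0)//.
  rewrite real_normK ?num_real//.
  set k := inner w u - L u.
  have u2 : 0 < `|u| ^+ 2 by rewrite exprn_gt0.
  have := Jm (w + (- k / `|u| ^+ 2) *: u).
  rewrite /J LD LZ !(innerDl, innerDr, innerZl, innerZr) (innerC u w).
  rewrite (inner_normE u) => h.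
  have h2 : k ^+ 2 / `|u| ^+ 2 <= d ^+ 2.
    suff : J w - k ^+ 2 / `|u| ^+ 2 >= m by move: Aw; rewrite /A /=; lra.
    apply: le_trans h _; rewrite le_eqVlt; apply/orP; left; apply/eqP.
    by rewrite /J /k; field; rewrite gt_eqF.
  by rewrite exprMn -ler_pdivrMr.
split=> // v' Lv'; apply/eqP; rewrite -subr_eq0; apply/eqP.
by apply: inner_eq0; rewrite {1}innerBl Lv Lv' subrr.
Qed.

End hilbert_theory.

Section wl2_def.
Context {R : realType} {I : choiceType} (w : I -> {posnum R}).

Let w_ge0 i : 0 <= (w i)%:num :> R. Proof. by []. Qed.

Definition wl2_pred : {pred I -> R} :=
  fun u => `[< sq_summable (fun i => (w i)%:num) u >].

Lemma wl2_submod_closed : submod_closed wl2_pred.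
Proof.
split=> [|a u v /asboolP us /asboolP vs]; apply/asboolP.
  exact: sq_summable0.
by apply: sq_summableD => //; exact: sq_summableZ.
Qed.

HB.instance Definition _ :=
  GRing.isSubmodClosed.Build R (I -> R) wl2_pred wl2_submod_closed.

Record wl2 := Wl2 { wl2_fun :> I -> R; _ : wl2_fun \in wl2_pred }.

HB.instance Definition _ := [isSub for wl2_fun].
HB.instance Definition _ := [Choice of wl2 by <:].
HB.instance Definition _ := [SubChoice_isSubLmodule of wl2 by <:].

Lemma wl2P (u : wl2) : sq_summable (fun i => (w i)%:num) u.
Proof. by case: u => u /= /asboolP. Qed.

Definition mk_wl2 u (us : sq_summable (fun i => (w i)%:num) u) : wl2 :=
  Wl2 (introT (asboolP _) us).

Definition wl2_inner (u v : wl2) : R := wdot (fun i => (w i)%:num) u v.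

Let innerC u v : wl2_inner u v = wl2_inner v u.
Proof. exact: wdotC. Qed.

Let innerDl (u v z : wl2) :
  wl2_inner (u + v) z = wl2_inner u z + wl2_inner v z.
Proof. by apply: wdotDl => //; exact: wl2P. Qed.

Let innerZl a (u v : wl2) : wl2_inner (a *: u) v = a * wl2_inner u v.
Proof. by apply: wdotZl => //; exact: wl2P. Qed.

Let inner_ge0 u : 0 <= wl2_inner u u.
Proof. exact: wdot_ge0. Qed.

Let inner_eq0 u : wl2_inner u u = 0 -> u = 0.
Proof.
move=> u0; apply/val_inj/funext => i /=.
by apply: (wdot_eq0 (w_ge0) (wl2P u) u0).
Qed.

Let inner_complete (F : set_system wl2) : ProperFilter F ->
  (forall e, 0 < e -> exists2 A, F A &
    forall u v, A u -> A v -> wl2_inner (u - v) (u - v) <= e) ->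
  exists l, forall e, 0 < e -> F [set u | wl2_inner (u - l) (u - l) <= e].
Proof.
move=> FF Fc.
have cvgi i : cvg ((fun u : wl2 => u i) @ F).
  apply: cvg_small_osc => e e0.
  have [|A FA Ae] := Fc ((w i)%:num * e ^+ 2).
    by rewrite mulr_gt0// exprn_gt0.
  exists A => // u v Au Av.
  have := le_trans (wdot_ge1 w_ge0 i (wl2P (u - v))) (Ae u v Au Av).
  rewrite ler_pM2l// -[X in X <= _]real_normK ?num_real//.
  by rewrite ler_pXn2r ?nnegrE// ltW.
have [ls lF] := @wdot_complete _ _ _ w_ge0 _ F (fun u : wl2 => u : I -> R)
  (fun i => lim ((fun u : wl2 => u i) @ F)) FF wl2P cvgi Fc.
by exists (mk_wl2 ls) => e /lF.
Qed.

HB.instance Definition _ := Lmodule_isHilbert.Build R wl2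
  innerC innerDl innerZl inner_ge0 inner_eq0 inner_complete.

End wl2_def.

Section operators.
Context {R : realType} {H : hilbertType R}.
Implicit Types (S T : set (H * H)) (u v w : H).

(* A possibly unbounded operator is represented by its graph. *)
Definition dom T : set H := [set u | exists v, T (u, v)].

Definition linear_operator T :=
  [/\ T (0, 0),
      forall a u v u' v', T (u, v) -> T (u', v') -> T (a *: u + u', a *: v + v')
    & forall u v v', T (u, v) -> T (u, v') -> v = v'].

Definition densely_defined T := dense (dom T).

Definition symmetric_op T :=
  forall u u' v v', T (u, u') -> T (v, v') -> inner u' v = inner u v'.

Definition adjoint T : set (H * H) :=
  [set p | forall u u', T (u, u') -> inner u' p.1 = inner u p.2].

Definition self_adjoint T := densely_defined T /\ adjoint T = T.

Definition essentially_self_adjoint T :=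
  [/\ densely_defined T, symmetric_op T & self_adjoint (closure T)].

Definition bounded_op T :=
  exists M : R, forall u v, T (u, v) -> `|v| <= M * `|u|.

Definition op_le S T :=
  forall u v w, S (u, v) -> T (u, w) -> inner v u <= inner w u.

Definition scalar_op (a : R) : set (H * H) := [set p | p.2 = a *: p.1].

Definition nonnegative_op T := op_le (scalar_op 0) T.

(* H is a real Hilbert space: the spectrum is that of the complexification
   of T, where the pair p stands for p.1 + i p.2. For real z this is the
   spectrum of T on H itself. *)
Definition cscale (z : R[i]) (u : H * H) : H * H :=
  (complex.Re z *: u.1 - complex.Im z *: u.2,
   complex.Re z *: u.2 + complex.Im z *: u.1).

Definition complexify T : set ((H * H) * (H * H)) :=
  [set p | T (p.1.1, p.2.1) /\ T (p.1.2, p.2.2)].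

Definition shifted T (z : R[i]) : set ((H * H) * (H * H)) :=
  [set p | exists2 v, complexify T (p.1, v) & p.2 = cscale z p.1 - v].

Definition resolvent_set T : set R[i] := [set z |
  (forall q : H * H, exists! p : H * H, shifted T z (p, q)) /\
  exists M : R, forall p q, shifted T z (p, q) -> `|p| <= M * `|q|].

Definition spectrum T : set R[i] := ~` resolvent_set T.

End operators.

Definition lspan (R : realType) (M : lmodType R) (I : Type) (g : I -> M) : set M :=
  [set v | exists s : seq (R * I), v = \sum_(p <- s) p.1 *: g p.2].

Record network (R : realType) := Network {
  vertex :> choiceType;
  adj : rel vertex;
  cond : vertex -> vertex -> R;
  vertex_infinite_countable : ([set: vertex] #= [set: nat])%card;
  adjC : symmetric adj;
  adjxx : irreflexive adj;
  adj_connected : forall x y, exists2 s, path adj x s & last x s = y;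
  adj_locally_finite : forall x, finite_set [set y | adj x y];
  cond_ge0 : forall x y, 0 <= cond x y;
  condC : forall x y, cond x y = cond y x;
  cond_gt0 : forall x y, (0 < cond x y) = adj x y
}.

Section network_theory.
Context {R : realType} (N : network R).
Implicit Types (x y o : N).

Definition total_cond x : R := \sum_(y \in [set y | adj x y]) cond x y.

Definition laplacian (f : N -> R) : N -> R :=
  fun x => \sum_(y \in [set y | adj x y]) cond x y * (f x - f y).

Definition markov (f : N -> R) : N -> R :=
  fun x => \sum_(y \in [set y | adj x y]) cond x y / total_cond x * f y.

Definition edge_diff (f : N -> R) : N * N -> R := fun p => f p.1 - f p.2.

Definition cond2 (p : N * N) : R := cond p.1 p.2.

Definition finite_energy (f : N -> R) := sq_summable cond2 (edge_diff f).

Definition energy (f g : N -> R) : R := 2^-1 * wdot cond2 (edge_diff f) (edge_diff g).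

Let cond2_ge0 p : 0 <= cond2 p. Proof. exact: cond_ge0. Qed.

Lemma vertex_ex : exists o : N, True.
Proof.
have /infinite_setN0 [x0 _] : infinite_set [set: N].
  by rewrite (eq_finite_set (vertex_infinite_countable N)); exact: infinite_nat.
by exists x0.
Qed.

Lemma has_neighbour x : exists y, adj x y.
Proof.
have [y yx] : exists y, y != x.
  apply: contrapT => h; have : infinite_set [set: N].
    rewrite (eq_finite_set (vertex_infinite_countable N)).
    exact: infinite_nat.
  apply; apply: (@sub_finite_set _ _ [set x]); last exact: finite_set1.
  move=> y _ /=; apply: contrapT => /eqP yx; by apply: h; exists y.
have [[|z s] /= ps l] := adj_connected x y.
  by rewrite l eqxx in yx.
by exists z; case/andP: ps.
Qed.

Lemma total_cond_gt0 x : 0 < total_cond x.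
Proof.
have [y xy] := has_neighbour x.
have fin := adj_locally_finite x.
rewrite /total_cond fsbig_finite//= (big_fsetD1 y)/=; last first.
  by rewrite in_fset_set // mem_setE.
by rewrite ltr_wpDr ?cond_gt0// sumr_ge0// => z _; exact: cond_ge0.
Qed.

Definition total_cond_pos x : {posnum R} := PosNum (total_cond_gt0 x).

Definition unit_weight : N -> {posnum R} := fun=> 1%:pos.

Definition ell2 := wl2 unit_weight.
HB.instance Definition _ := Hilbert.on ell2.

Definition ell2c := wl2 total_cond_pos.
HB.instance Definition _ := Hilbert.on ell2c.

Definition fin_energy_pred : {pred N -> R} := fun f => `[< finite_energy f >].

Lemma fin_energy_submod_closed : submod_closed fin_energy_pred.
Proof.
split=> [|a u v /asboolP us /asboolP vs]; apply/asboolP; rewrite /finite_energy.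
  rewrite (_ : edge_diff _ = fun=> 0); first exact: sq_summable0.
  by apply/funext => p; rewrite /edge_diff subrr.
rewrite (_ : edge_diff _ = fun p => a * edge_diff u p + edge_diff v p).
  by apply: (sq_summableD cond2_ge0) => //; exact: sq_summableZ.
apply/funext => p.
change ((a * u p.1 + v p.1) - (a * u p.2 + v p.2) =
  a * (u p.1 - u p.2) + (v p.1 - v p.2)); ring.
Qed.

HB.instance Definition _ := GRing.isSubmodClosed.Build R (N -> R)
  fin_energy_pred fin_energy_submod_closed.

Record fin_energy := FinEnergy {
  fin_energy_fun :> N -> R; _ : fin_energy_fun \in fin_energy_pred }.

HB.instance Definition _ := [isSub for fin_energy_fun].
HB.instance Definition _ := [Choice of fin_energy by <:].
HB.instance Definition _ := [SubChoice_isSubLmodule of fin_energy by <:].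

Lemma fin_energyP (f : fin_energy) : finite_energy f.
Proof. by case: f => f /= /asboolP. Qed.

Definition mk_fin_energy (f : N -> R) (fE : finite_energy f) : fin_energy :=
  FinEnergy (introT (asboolP _) fE).

Definition constant_fun : {pred fin_energy} :=
  fun f => `[< forall x y, f x = f y >].

Lemma constant_fun_zmod_closed : zmod_closed constant_fun.
Proof.
split=> [|f g /asboolP fE /asboolP gE]; apply/asboolP => x y //=.
by congr (_ - _).
Qed.

HB.instance Definition _ :=
  GRing.isZmodClosed.Build fin_energy constant_fun constant_fun_zmod_closed.

(* Finite energy functions modulo constants. By [energy_inner] and the
   instance of [Lmodule_isHilbert] below, this quotient is already complete. *)
Definition energy_space := Quotient.quot constant_fun.
HB.instance Definition _ := GRing.Zmodule.on energy_space.
HB.instance Definition _ := EqQuotient.on energy_space.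

Definition eclass (f : fin_energy) : energy_space := \pi f.

Lemma eclass_eq (f g : fin_energy) :
  eclass f = eclass g <-> edge_diff f = edge_diff g.
Proof.
have -> : eclass f = eclass g <-> (f - g) \in constant_fun.
  rewrite /eclass Quotient.idealrBE; split=> [->//|]; exact/eqP.
split=> [/asboolP fg|fg].
  apply/funext => -[x y]; have h : f x - g x = f y - g y := fg x y.
  by rewrite /edge_diff /=; lra.
apply/asboolP => x y.
have h : f x - f y = g x - g y := congr1 (fun k => k (x, y)) fg.
by change (f x - g x = f y - g y); lra.
Qed.

Lemma edge_diff_repr (f : fin_energy) :
  edge_diff (repr (eclass f)) = edge_diff f.
Proof. by apply/eclass_eq; rewrite /eclass reprK. Qed.

Lemma eclass_repr (q : energy_space) : eclass (repr q) = q.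
Proof. exact: reprK. Qed.

Lemma edge_diffD (f g : fin_energy) :
  edge_diff (f + g) = fun p => edge_diff f p + edge_diff g p.
Proof.
apply/funext => p.
change ((f p.1 + g p.1) - (f p.2 + g p.2) = (f p.1 - f p.2) + (g p.1 - g p.2)).
ring.
Qed.

Lemma edge_diffZ a (f : fin_energy) :
  edge_diff (a *: f) = fun p => a * edge_diff f p.
Proof.
apply/funext => p; change (a * f p.1 - a * f p.2 = a * (f p.1 - f p.2)); ring.
Qed.

Lemma eclassD (f g : fin_energy) : eclass (f + g) = eclass f + eclass g.
Proof. by rewrite /eclass piE. Qed.

Let escale (a : R) (q : energy_space) : energy_space := eclass (a *: repr q).

Let escaleE a f : escale a (eclass f) = eclass (a *: f).
Proof. by apply/eclass_eq; rewrite !edge_diffZ edge_diff_repr. Qed.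

Let escaleA a b q : escale a (escale b q) = escale (a * b) q.
Proof. by rewrite [escale b q]/escale escaleE scalerA. Qed.

Let escale1 q : escale 1 q = q.
Proof. by rewrite /escale scale1r eclass_repr. Qed.

Let escaleDr : right_distributive escale +%R.
Proof.
move=> a p q; rewrite -[p]eclass_repr -[q]eclass_repr -eclassD !escaleE.
by rewrite scalerDr eclassD.
Qed.

Let escaleDl q : {morph (fun a => escale a q) : a b / a + b}.
Proof. by move=> a b; rewrite /escale scalerDl eclassD. Qed.

HB.instance Definition _ := GRing.Zmodule_isLmodule.Build R energy_space
  escaleA escale1 escaleDr escaleDl.

Lemma eclassZ a f : eclass (a *: f) = a *: eclass f.
Proof. by rewrite -escaleE. Qed.

Definition energy_inner (p q : energy_space) : R := energy (repr p) (repr q).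

Lemma energy_innerE (f g : fin_energy) : energy_inner (eclass f) (eclass g) = energy f g.
Proof. by rewrite /energy_inner /energy !edge_diff_repr. Qed.

Let innerC p q : energy_inner p q = energy_inner q p.
Proof. by rewrite /energy_inner /energy wdotC. Qed.

Let innerDl p q r :
  energy_inner (p + q) r = energy_inner p r + energy_inner q r.
Proof.
rewrite -[p]eclass_repr -[q]eclass_repr -[r]eclass_repr -eclassD !energy_innerE.
rewrite /energy edge_diffD (wdotDl cond2_ge0) ?mulrDr//; exact: fin_energyP.
Qed.

Let innerZl a p q : energy_inner (a *: p) q = a * energy_inner p q.
Proof.
rewrite -[p]eclass_repr -[q]eclass_repr -eclassZ !energy_innerE.
rewrite /energy edge_diffZ (wdotZl cond2_ge0) 1?mulrCA//; exact: fin_energyP.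
Qed.

Let inner_ge0 p : 0 <= energy_inner p p.
Proof. by rewrite mulr_ge0 ?invr_ge0//; exact: wdot_ge0. Qed.

Lemma diff_le_energy x y : exists2 M : R, 0 <= M & forall f : fin_energy,
  `|f x - f y| <= M * Num.sqrt (energy f f).
Proof.
have [s] := adj_connected x y; elim: s x => [|z s IH] x /=.
  by move=> _ ->; exists 0 => // f; rewrite subrr normr0 mul0r.
move=> /andP[xz zs] /(IH _ zs)[M M0 fM].
have cxz : 0 < cond x z by rewrite cond_gt0.
exists (Num.sqrt (2 / cond x z) + M) => [|f]; first by rewrite addr_ge0// sqrtr_ge0.
have -> : f x - f y = (f x - f z) + (f z - f y) by ring.
rewrite mulrDl (le_trans (ler_normD _ _))// lerD//.
have c0 : 0 <= 2 / cond x z by rewrite divr_ge0// ltW.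
rewrite -sqrtrM// -(sqrtr_sqr (f x - f z)); apply: ler_wsqrtr.
have := wdot_ge1 cond2_ge0 (x, z) (fin_energyP f).
rewrite /cond2 /edge_diff /= mulrC -ler_pdivlMr// => h; apply: le_trans h _.
by rewrite /energy le_eqVlt; apply/orP; left; apply/eqP; field; rewrite gt_eqF.
Qed.

Let inner_eq0 p : energy_inner p p = 0 -> p = 0.
Proof.
move=> p0; rewrite -[p]eclass_repr -[0]eclass_repr; apply/eclass_eq.
apply/funext => -[x y].
have [M _ fM] := diff_le_energy x y.
have ed0 q : energy_inner q q = 0 -> edge_diff (repr q) (x, y) = 0.
  move=> q0; apply/eqP; rewrite -normr_le0.
  by have := fM (repr q); rewrite -/(energy_inner q q) q0 sqrtr0 mulr0.
rewrite !ed0//; have := innerZl 0 p p.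
by rewrite scale0r mul0r innerC => h; have := innerZl 0 p 0; rewrite scale0r mul0r.
Qed.

Let inner_complete (F : set_system energy_space) : ProperFilter F ->
  (forall e, 0 < e -> exists2 A, F A &
    forall p q, A p -> A q -> energy_inner (p - q) (p - q) <= e) ->
  exists l, forall e, 0 < e -> F [set p | energy_inner (p - l) (p - l) <= e].
Proof.
move=> FF Fc; have [x0 _] := vertex_ex.
have edB (p q : energy_space) :
    edge_diff (repr (p - q)) = fun i => edge_diff (repr p) i - edge_diff (repr q) i.
  rewrite -[in LHS](eclass_repr p) -[in LHS](eclass_repr q) -scaleN1r -eclassZ -eclassD.
  rewrite edge_diff_repr edge_diffD edge_diffZ; apply/funext => i; ring.
have cvgx x : cvg ((fun p : energy_space => edge_diff (repr p) (x, x0)) @ F).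
  have [M M0 fM] := diff_le_energy x x0.
  apply: cvg_small_osc => e e0.
  have d0 : 0 < e / (M + 1) by rewrite divr_gt0// ltr_wpDl.
  have [A FA Ae] := Fc _ (exprn_gt0 2 d0).
  exists A => // p q Ap Aq.
  have := fM (repr (p - q)); rewrite -/(energy_inner _ _).
  have -> : repr (p - q) x - repr (p - q) x0 = edge_diff (repr (p - q)) (x, x0) by [].
  rewrite edB => h; apply: le_trans h _.
  have : Num.sqrt (energy_inner (p - q) (p - q)) <= e / (M + 1).
    by rewrite -[leRHS]ger0_norm ?(ltW d0)// -(sqrtr_sqr (e / _)); apply: ler_wsqrtr; exact: Ae.
  move=> h; apply: le_trans (ler_wpM2l M0 h) _.
  by rewrite mulrCA ger_pMr// ler_pdivrMr ?ltr_wpDl// mul1r lerDl.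
pose l x := lim ((fun p : energy_space => edge_diff (repr p) (x, x0)) @ F).
have cvgl i : (fun p : energy_space => edge_diff (repr p) i) @ F --> edge_diff l i.
  case: i => x y.
  rewrite (_ : (fun p : energy_space => _) = (fun p : energy_space =>
    edge_diff (repr p) (x, x0) - edge_diff (repr p) (y, x0))).
    by apply: cvgB; [exact: cvgx x|exact: cvgx y].
  by apply/funext => p; rewrite /edge_diff /=; ring.
have [||ls lF] := @wdot_complete _ _ _ cond2_ge0 _ F
  (fun p : energy_space => edge_diff (repr p)) (edge_diff l) FF _ cvgl.
- by move=> p; exact: fin_energyP.
- move=> e e0; have [A FA Ae] := Fc (e / 2) (divr_gt0 e0 (ltr0n _ 2)).
  exists A => // p q Ap Aq; have := Ae p q Ap Aq.
  by rewrite /energy_inner /energy edB; lra.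
exists (eclass (mk_fin_energy ls)) => e e0.
have := lF (2 * e) (mulr_gt0 (ltr0n _ 2) e0); apply: filterS => p /=.
by rewrite /energy_inner /energy edB edge_diff_repr /=; lra.
Qed.

HB.instance Definition _ := Lmodule_isHilbert.Build R energy_space
  innerC innerDl innerZl inner_ge0 inner_eq0 inner_complete.

(* [u x - u o] does not depend on the representative: see [potential_diffE]. *)
Definition potential_diff (q : energy_space) x o : R := repr q x - repr q o.

Lemma potential_diffE (f : fin_energy) x o :
  potential_diff (eclass f) x o = f x - f o.
Proof.
exact: (congr1 (fun k : N * N -> R => k (x, o)) (edge_diff_repr f)).
Qed.

Lemma dipole_ex o x :
  exists! v : energy_space, forall u, inner v u = potential_diff u x o.
Proof.
have [M M0 fM] := diff_le_energy x o.
apply: (riesz (M := M)) => [u v|a u|u].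
- rewrite -[u]eclass_repr -[v]eclass_repr -eclassD !potential_diffE.
  by change ((repr u x + repr v x) - (repr u o + repr v o) =
    (repr u x - repr u o) + (repr v x - repr v o)); ring.
- rewrite -[u]eclass_repr -eclassZ !potential_diffE.
  by change (a * repr u x - a * repr u o = a * (repr u x - repr u o)); ring.
- have -> : `|u| = Num.sqrt (energy (repr u) (repr u)).
    by rewrite -/(energy_inner u u) -[energy_inner u u]/(inner u u) inner_normE
      sqrtr_sqr normr_id.
  exact: fM.
Qed.

Definition dipole o x : energy_space := sval (cid (dipole_ex o x)).

Lemma dipoleP o x u : inner (dipole o x) u = potential_diff u x o.
Proof. by rewrite /dipole; case: cid => v []. Qed.

Lemma delta_sq_summable x :
  sq_summable (fun y => (unit_weight y)%:num) (fun y : N => (y == x)%:R).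
Proof.
apply: (@sq_summable_finite _ _ _ _ [set x]); first exact: finite_set1.
by move=> y /= /eqP/negbTE ->.
Qed.

Definition delta x : ell2 := mk_wl2 (delta_sq_summable x).

Definition laplacian_ell2_core : set (ell2 * ell2) :=
  [set p : ell2 * ell2 |
    lspan delta p.1 /\ p.2 = laplacian p.1 :> (N -> R)].

Definition laplacian_ell2 : set (ell2 * ell2) := closure laplacian_ell2_core.

Definition laplacian_energy_core o : set (energy_space * energy_space) :=
  [set p : energy_space * energy_space |
    lspan (dipole o) p.1 /\ exists f g : fin_energy,
    [/\ eclass f = p.1, eclass g = p.2 & g = laplacian f :> (N -> R)]].

Definition laplacian_energy o : set (energy_space * energy_space) :=
  closure (laplacian_energy_core o).

Definition markov_ell2c : set (ell2c * ell2c) :=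
  [set p : ell2c * ell2c | p.2 = markov p.1 :> (N -> R)].

Lemma lspan_delta_finite (u : ell2) : lspan delta u ->
  exists2 A : set N, finite_set A & forall x, ~ A x -> u x = 0.
Proof.
move=> [s ->]; exists [set` map snd s]; first exact: finite_seq.
elim: s => [|[a y] s IH] x /=; first by rewrite big_nil.
rewrite big_cons inE => /negP; rewrite negb_or => /andP[xy xs].
have h : (\sum_(p <- s) p.1 *: delta p.2) x = 0 by apply: IH; exact/negP.
change (a * (x == y)%:R + (\sum_(p <- s) p.1 *: delta p.2) x = 0).
by rewrite h (negbTE xy) mulr0 addr0.
Qed.

(* The domain of the minimal Laplacian is all of span{delta_x}. *)
Lemma dom_laplacian_ell2_core : dom laplacian_ell2_core = lspan delta.
Proof.
apply/seteqP; split=> [u [v []]//|u us].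
have [A Af uA] := lspan_delta_finite us.
have lf : sq_summable (fun y => (unit_weight y)%:num) (laplacian u).
  apply: (@sq_summable_finite _ _ _ _
    (A `|` \bigcup_(x in A) [set y | adj x y])).
    rewrite finite_setU; split=> //.
    by apply: bigcup_finite => // x _; exact: adj_locally_finite.
  move=> x xA; rewrite /laplacian fsbig1// => y /= xy.
  have ux : u x = 0 by apply: uA => Ax; apply: xA; left.
  have uy : u y = 0.
    by apply: uA => Ay; apply: xA; right; exists y => //=; rewrite adjC.
  by rewrite ux uy subrr mulr0.
by exists (mk_wl2 lf).
Qed.

End network_theory.

Arguments laplacian_ell2 {R} N.
Arguments markov_ell2c {R} N.
Arguments laplacian_energy {R N} o.

(* Main.v *)
Require Import Defs.
From mathcomp Require Import all_boot all_order all_algebra.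
From mathcomp Require Import all_classical all_reals all_analysis.
From mathcomp Require Import complex finmap ring lra zify.

Import Order.TTheory GRing.Theory Num.Theory numFieldNormedType.Exports.

Local Open Scope classical_set_scope.
Local Open Scope ring_scope.

(** The two Laplacians are closures of operators given on explicit spanning
families, and what has to be known about them follows from the values of these
operators on the families.

- The Gauss-Green identity [energy_indicator], E(f, delta_x) = (Delta f)(x),
  turns the Laplacian on the energy space into an inner product with delta_x.
  With the reproducing property of the dipoles it gives
  Delta v_x = delta_x - delta_o, and then
  <Delta v_x, u> = (Delta u)(x) - (Delta u)(o) = <v_x, Delta u>
  for all u such that u and Delta u have finite energy. Hence the operator on
  span {v_x} is symmetric. It is nonnegative since
  E(f, Delta f) = sum_y (Delta f)(y)^2 when Delta f has finite support. The
  domain is dense because an element orthogonal to all dipoles is constant. A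
  symmetric operator with dense domain lies inside its closed adjoint, so its
  closure is again the graph of a symmetric operator
  ([closure_linear_operator]).

- The obstruction to self-adjointness is an eigenvector w <> 0 of the adjoint
  for the eigenvalue -1: a nonnegative operator that equals its adjoint has
  none, and neither has a bounded nonnegative one with dense domain
  ([negative_adjoint]). On the half-line 0 - 1 - 2 - ... the function
  w(n) = 2 - 2^-n is such an eigenvector when the edge from n to n+1 has
  conductance n 2^(n+2) + 2: the current through that edge is then
  2n + 2^-n = w(0) + ... + w(n), that is, Delta w = - w, and the energy of w is
  a convergent sum of terms of order n 2^-n.

- In l^2(V) the criterion [closure_self_adjoint] applies: a nonnegative
  symmetric T with dense domain has a self-adjoint closure as soon as its
  adjoint has no eigenvector for -1. The adjoint of the Laplacian acts pointwise
  as Delta, and Delta u = - u with u in l^2 is impossible for u <> 0 by the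
  maximum principle: since the values of u tend to 0 a positive value of u would
  lead to a positive maximum, where Delta u is nonnegative and - u negative.
  Unboundedness is seen on delta_x, since (Delta delta_x)(x) = c(x).

- The Markov operator is a contraction of l^2(V, c) by Jensen's inequality for
  the probabilities p(x, .) and by the reversibility c_xy = c_yx. It is symmetric
  on the functions delta_x, hence everywhere. For the spectrum, with
  A = Re z - P, one has (conj z - P) (z - P) = A^2 + (Im z)^2; this symmetric
  operator is bounded below by a positive constant for z outside [-1, 1], and so
  it is invertible ([symmetric_onto]).

Both density statements and both surjectivity statements come from
[orthogonal_dense]: a subspace of a Hilbert space with trivial orthogonal
complement is dense. *)

Set Implicit Arguments.
Unset Strict Implicit.
Unset Printing Implicit Defensive.

(** * Density and orthogonality in Hilbert spaces *)

Definition linear_subspace (R : realType) (V : lmodType R) (S : set V) :=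
  S 0 /\ forall a u v, S u -> S v -> S (a *: u + v).

Section subspaces.
Context {R : realType}.

Lemma closure_normP (V : normedModType R) (A : set V) p :
  closure A p <-> forall e, 0 < e -> exists2 a, A a & `|p - a| < e.
Proof.
split=> [Ap e e0|h B /nbhs_ballP[e /= e0 eB]].
  have [a [Aa]] := Ap _ (nbhsx_ballx p e e0).
  by rewrite -ball_normE => pa; exists a.
by have [a Aa pa] := h e e0; exists a; split=> //; apply: eB; rewrite -ball_normE.
Qed.

Lemma dense_closureP (V : normedModType R) (A : set V) :
  dense A <-> forall p, closure A p.
Proof.
split=> [dA p B|h O [p Op] Oo].
  rewrite nbhsE; move=> [G [Go Gp] GB].
  have [q [Gq Aq]] := dA G (ex_intro _ p Gp) Go.
  by exists q; split=> //; exact: GB.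
have [q [Aq Oq]] := h p O (open_nbhs_nbhs (conj Oo Op)).
by exists q.
Qed.

Lemma dense_subset (V : normedModType R) (A B : set V) :
  A `<=` B -> dense A -> dense B.
Proof.
move=> AB /dense_closureP dA; apply/dense_closureP => p.
exact: closureS AB _ (dA p).
Qed.

Lemma closure_linear_subspace (V : normedModType R) (S : set V) :
  linear_subspace S -> linear_subspace (closure S).
Proof.
move=> [S0 SD]; split=> [|a u v Su Sv]; first exact: subset_closure.
apply/closure_normP => e e0.
have k0 : 0 < `|a| + 1 by rewrite ltr_wpDl.
have d0 : 0 < e / (`|a| + 1) by rewrite divr_gt0.
have [|u' Su' uu'] := (closure_normP _ _).1 Su (e / 2 / (`|a| + 1)).
  by rewrite divr_gt0// divr_gt0.
have [|v' Sv' vv'] := (closure_normP _ _).1 Sv (e / 2); first by rewrite divr_gt0.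
exists (a *: u' + v'); first exact: SD.
have -> : a *: u + v - (a *: u' + v') = a *: (u - u') + (v - v').
  by rewrite scalerBr opprD addrACA.
apply: le_lt_trans (ler_normD _ _) _; rewrite normrZ.
suff : `|a| * `|u - u'| <= e / 2 by lra.
apply: le_trans (_ : (`|a| + 1) * `|u - u'| <= _).
  by rewrite ler_wpM2r// lerDl.
by rewrite mulrC -ler_pdivlMr// ltW.
Qed.

Lemma lspan_linear_subspace (V : lmodType R) (I : Type) (g : I -> V) :
  linear_subspace (lspan g).
Proof.
split=> [|a _ _ [s ->] [t ->]]; first by exists [::]; rewrite big_nil.
exists ([seq (a * p.1, p.2) | p <- s] ++ t).
rewrite big_cat big_map scaler_sumr /=; congr (_ + _).
by apply: eq_bigr => p _; rewrite scalerA.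
Qed.

Lemma lspan_gen (V : lmodType R) (I : Type) (g : I -> V) i : lspan g (g i).
Proof. by exists [:: (1, i)]; rewrite big_seq1 scale1r. Qed.

(** The induction principle for spans: [S] collects the vectors that have the
property to be proved. *)
Lemma lspan_min (V : lmodType R) (I : Type) (g : I -> V) (S : set V) :
  linear_subspace S -> (forall i, S (g i)) -> lspan g `<=` S.
Proof.
move=> [S0 SD] Sg _ [s ->]; elim: s => [|p s IH]; first by rewrite big_nil.
by rewrite big_cons; apply: SD.
Qed.

End subspaces.

Section hilbert.
Context {R : realType} {H : hilbertType R}.
Implicit Types (u v w d h : H) (M : set H) (S T : set (H * H)).

Lemma inner0l u : inner 0 u = 0.
Proof. by rewrite -(scale0r 0) innerZl mul0r. Qed.

Lemma inner0r u : inner u 0 = 0.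
Proof. by rewrite innerC inner0l. Qed.

Lemma innerNl u v : inner (- u) v = - inner u v.
Proof. by rewrite -scaleN1r innerZl mulN1r. Qed.

Lemma innerNr u v : inner u (- v) = - inner u v.
Proof. by rewrite innerC innerNl innerC. Qed.

Lemma innerBr u v w : inner w (u - v) = inner w u - inner w v.
Proof. by rewrite innerDr innerNr. Qed.

(** By polarization, from the continuity of the norm. *)
Lemma inner_continuous : continuous (fun p : H * H => inner p.1 p.2).
Proof.
have -> : (fun p : H * H => inner p.1 p.2) =
    fun p => 4^-1 * (`|p.1 + p.2| * `|p.1 + p.2| - `|p.1 - p.2| * `|p.1 - p.2|).
  apply/funext => -[u v] /=.
  rewrite -!expr2 -!inner_normE !(innerDl, innerDr, innerNl, innerNr) (innerC v u).
  by field.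
move=> p; have c1 : {for p, continuous (fun p : H * H => p.1)} by exact: cvg_fst.
have c2 : {for p, continuous (fun p : H * H => p.2)} by exact: cvg_snd.
have cD : {for p, continuous (fun p : H * H => `|p.1 + p.2|)}.
  by apply: cvg_norm; apply: cvgD.
have cB : {for p, continuous (fun p : H * H => `|p.1 - p.2|)}.
  by apply: cvg_norm; apply: cvgB.
by apply: cvgMr; apply: cvgB; apply: cvgM.
Qed.

Lemma dense_orthogonal M d : dense M -> (forall m, M m -> inner m d = 0) -> d = 0.
Proof.
move=> /dense_closureP/(_ d)/closure_normP dM Md.
have [//|d0] := eqVneq d 0; have dp : 0 < `|d| by rewrite normr_gt0.
have [m Mm dm] := dM _ dp.
have := cauchy_schwarz (d - m) d; rewrite innerBl (Md m Mm) subr0 inner_normE.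
rewrite ger0_norm ?sqr_ge0// expr2 ler_pM2r// => h.
by have := le_lt_trans h dm; rewrite ltxx.
Qed.

(** The points of [M] at almost minimal distance from a given h form a Cauchy
filter; h minus the limit is orthogonal to [M], hence zero. *)
Lemma orthogonal_dense M : linear_subspace M ->
  (forall d, (forall m, M m -> inner m d = 0) -> d = 0) -> dense M.
Proof.
move=> [M0 MD] Mperp; apply/dense_closureP => h.
pose D := [set `|h - m| ^+ 2 | m in M].
have Dlb : has_lbound D by exists 0 => _ [m _ <-]; rewrite sqr_ge0.
have Dinf : has_inf D by split=> //; exists (`|h - 0| ^+ 2), 0.
pose A e := [set m | M m /\ `|h - m| ^+ 2 <= inf D + e].
have AS e e' : e <= e' -> A e `<=` A e'.
  by move=> ee2 m [Mm hm]; split=> //; apply: le_trans hm _; rewrite lerD2l.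
have infD m : M m -> inf D <= `|h - m| ^+ 2 by move=> Mm; apply: ge_inf => //; exists m.
pose F := filter_from [set e : R | 0 < e] A.
have FF : ProperFilter F.
  apply: filter_from_proper; first apply: filter_from_filter.
  - by exists 1 => /=.
  - move=> i j /= i0 j0; exists (Num.min i j); first by rewrite /= lt_min i0.
    by move=> v Av; split; apply: AS Av; rewrite ge_min lexx ?orbT.
  - move=> e /= e0; have [_ [v Mv <-] hv] := inf_adherent e0 Dinf.
    by exists v; split=> //; exact: ltW.
have Adist e u v : A e u -> A e v -> `|u - v| ^+ 2 <= 4 * e.
  move=> [Mu hu] [Mv hv].
  (* The parallelogram identity, with the midpoint of u and v as competitor. *)
  have Mm : M (2^-1 *: (u + v)).
    rewrite -[_ *: _]addr0; apply: (MD) => //.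
    by rewrite -[u]scale1r; exact: MD.
  have := infD _ Mm; rewrite -!inner_normE in hu hv *.
  move: hu hv.
  rewrite !(innerDl, innerDr, innerZl, innerZr, innerNl, innerNr) (innerC v u) (innerC u h) (innerC v h).
  lra.
have : cvg F.
  apply/cauchy_cvgP/cauchy_ballP => e e0.
  exists (A (e ^+ 2 / 8), A (e ^+ 2 / 8)).
    by split; exists (e ^+ 2 / 8) => //=; rewrite divr_gt0 ?exprn_gt0.
  move=> [u v] /= [Au Av]; rewrite -ball_normE /=.
  rewrite -(@ltr_pXn2r _ 2)// ?nnegrE ?(ltW e0)//.
  apply: le_lt_trans (Adist _ _ _ Au Av) _.
  by have := exprn_gt0 2 e0; lra.
move=> /cvg_ex[p Fp].
have Fnear e : 0 < e -> F [set m | `|p - m| < e].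
  move=> e0; apply: Fp; apply/nbhs_ballP; exists e => //= w.
  by rewrite -ball_normE.
have clp : closure M p.
  apply/closure_normP => e e0.
  have FA : F (A e) by exists e.
  by have [m [/= pm [Mm _]]] := filter_ex (filterI (Fnear e e0) FA); exists m.
have infDp e : 0 < e -> exists2 m, M m & `|p - m| < e /\ `|h - m| ^+ 2 <= inf D + e ^+ 2.
  move=> e0; have FA : F (A (e ^+ 2)) by exists (e ^+ 2) => //=; rewrite exprn_gt0.
  by have [m [/= pm [Mm hm]]] := filter_ex (filterI (Fnear e e0) FA); exists m.
suff -> : h = p by [].
apply/eqP; rewrite -subr_eq0; apply/eqP; apply: Mperp => u Mu.
have [->|u0] := eqVneq u 0; first by rewrite inner0l.
have up : 0 < `|u| by rewrite normr_gt0.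
apply/eqP; rewrite -normr_le0; apply/ler_addgt0Pr => e e0; rewrite add0r.
(* Both parts of <u, h - p> = <u, h - m> + <u, m - p> are at most c |u|. *)
pose c := e / (2 * `|u|).
have c0 : 0 < c by rewrite divr_gt0 // mulr_gt0.
have [m Mm [pm hm]] := infDp _ c0.
have -> : inner u (h - p) = inner u (h - m) + inner u (m - p).
  by rewrite -innerDr addrA subrK.
apply: le_trans (ler_normD _ _) _.
have -> : e = `|u| * c + `|u| * c.
  by rewrite /c; field; rewrite gt_eqF.
clearbody c; apply: lerD; last first.
  by apply: le_trans (cauchy_schwarz _ _) _; rewrite ler_wpM2l// distrC ltW.
set q := h - m in hm *; set k := inner u q.
have u2 : 0 < `|u| ^+ 2 by rewrite exprn_gt0.
(* Moving m along u by the optimal step k / |u|^2 lowers the squared distance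
   to h by k^2 / |u|^2, and no more than c^2 is left to gain. *)
have : inf D <= `|h - ((k / `|u| ^+ 2) *: u + m)| ^+ 2 by apply: infD; exact: MD.
have -> : h - ((k / `|u| ^+ 2) *: u + m) = q - (k / `|u| ^+ 2) *: u.
  by rewrite opprD addrCA addrC.
clearbody q; rewrite -inner_normE innerBl !innerBr !(innerZl, innerZr) (innerC q u) -/k.
rewrite !inner_normE => hk.
have h2 : k ^+ 2 / `|u| ^+ 2 <= c ^+ 2.
  suff : inf D <= `|q| ^+ 2 - k ^+ 2 / `|u| ^+ 2 by lra.
  apply: le_trans hk _; rewrite le_eqVlt; apply/orP; left; apply/eqP.
  by field; rewrite gt_eqF.
rewrite -(@ler_pXn2r _ 2)// ?nnegrE ?mulr_ge0 ?(ltW c0)//.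
by rewrite real_normK ?num_real// exprMn mulrC -ler_pdivrMr.
Qed.

(** The range of T is dense, and the bound |u| <= C |v| makes the preimages of
a sequence converging to h a Cauchy sequence. *)
Lemma bounded_below_onto T (C : R) : linear_subspace T ->
  (forall u v, T (u, v) -> `|u| <= C * `|v|) ->
  (forall d, (forall u v, T (u, v) -> inner v d = 0) -> d = 0) ->
  forall h, exists u, closure T (u, h).
Proof.
move=> [T0 TD] TC Tperp h.
have C0 : 0 < `|C| + 1 by rewrite ltr_wpDl.
have {}TC u v : T (u, v) -> `|u| <= (`|C| + 1) * `|v|.
  move=> /TC/le_trans; apply; rewrite ler_wpM2r// ler_wpDr//; exact: ler_norm.
have Rdense : dense [set v | exists u, T (u, v)].
  apply: orthogonal_dense; first split.
  - by exists 0.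
  - by move=> a v v' [u uv] [u' uv']; exists (a *: u + u'); exact: (TD a (u, v) (u', v')).
  - by move=> d dp; apply: Tperp => u v uv; apply: dp; exists u.
pose A e := [set p | T p /\ `|h - p.2| < e].
pose F := filter_from [set e : R | 0 < e] A.
have FF : ProperFilter F.
  apply: filter_from_proper; first apply: filter_from_filter.
  - by exists 1 => /=.
  - move=> i j /= i0 j0; exists (Num.min i j); first by rewrite /= lt_min i0.
    by move=> v [Tv]; rewrite lt_min => /andP[? ?].
  - move=> e /= e0.
    have [v [u uv] hv] := (closure_normP _ _).1 ((dense_closureP _).1 Rdense h) e e0.
    by exists (u, v).
have : cvg (fst @ F).
  apply/cauchy_cvgP/cauchy_ballP => e e0.
  pose d := e / (2 * (`|C| + 1)).
  have d0 : 0 < d by rewrite divr_gt0// mulr_gt0.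
  exists (fst @` A d, fst @` A d).
    by split; exists d => //= p Ap; exists p.
  move=> [_ _] /= [[p [Tp hp] <-] [q [Tq hq] <-]].
  rewrite -ball_normE /=.
  have Tpq : T (p.1 - q.1, p.2 - q.2).
    have := TD (-1) q p Tq Tp; rewrite !scaleN1r.
    by rewrite [_ + p]addrC; case: (p) (q) => ? ? [].
  apply: le_lt_trans (TC _ _ Tpq) _.
  have -> : p.2 - q.2 = (h - q.2) - (h - p.2).
    by rewrite opprB [RHS]addrC subrKA.
  rewrite mulrC -ltr_pdivlMr//; apply: le_lt_trans (ler_normB _ _) _.
  have -> : e / (`|C| + 1) = d + d by rewrite /d; field; rewrite gt_eqF.
  exact: ltrD.
move=> /cvg_ex[u Fu]; exists u; apply/closure_normP => e e0.
have Fnear : F [set p | `|u - p.1| < e].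
  by have := Fu _ (nbhsx_ballx u e e0); rewrite -ball_normE.
have FA : F (A e) by exists e.
have [p [/= up [Tp hp]]] := filter_ex (filterI Fnear FA).
by exists p => //; rewrite prod_normE /= gt_max up.
Qed.

End hilbert.

(** * Closures and adjoints of graphs *)

Section closures.
Context {R : realType} {H : hilbertType R}.
Implicit Types (u v w d h : H) (S T : set (H * H)).

Lemma closed_zeros (V : topologicalType) (f : V -> R) :
  continuous f -> closed [set x | f x = 0].
Proof.
move=> cf; exact: (preimage_closed (fun x _ => cf x) (@closed_eq _ 0)).
Qed.

Lemma closed_nneg (V : topologicalType) (f : V -> R) :
  continuous f -> closed [set x | 0 <= f x].
Proof.
move=> cf; exact: (preimage_closed (fun x _ => cf x) (@closed_ge _ 0)).
Qed.

Lemma inner_continuousr u : continuous (inner u : H -> R).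
Proof.
move=> v; apply: (@continuous_comp _ _ _ (fun v => (u, v))
  (fun p : H * H => inner p.1 p.2)); last exact: inner_continuous.
by apply: cvg_pair => //; exact: cvg_cst.
Qed.

Lemma closed_adjoint T : closed (adjoint T).
Proof.
have -> : adjoint T =
    \bigcap_(q in T) [set p | inner q.2 p.1 - inner q.1 p.2 = 0].
  apply/seteqP; split=> p Tp.
    by move=> [u u'] /= /Tp /= ->; rewrite subrr.
  by move=> u u' /Tp /= /eqP; rewrite subr_eq0 => /eqP.
apply: closed_bigI => -[u u'] _; apply: closed_zeros => p.
apply: cvgB; [apply: (@continuous_comp _ _ _ fst (inner u'))
             |apply: (@continuous_comp _ _ _ snd (inner u))];
  [exact: cvg_fst|exact: inner_continuousr|exact: cvg_snd|exact: inner_continuousr].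
Qed.

Lemma adjointS S T : S `<=` T -> adjoint T `<=` adjoint S.
Proof. by move=> ST p Tp u u' /ST/Tp. Qed.

Lemma sub_adjointC S T : S `<=` adjoint T -> T `<=` adjoint S.
Proof. by move=> ST [a b] Tab u v /ST/(_ _ _ Tab) /= h; rewrite innerC -h innerC. Qed.

(** Taking adjoints is a Galois connection on graphs and adjoints are closed, so
that an operator and its closure have the same adjoint. *)
Lemma adjoint_closure T : adjoint (closure T) = adjoint T.
Proof.
apply/seteqP; split; first exact/adjointS/subset_closure.
apply: sub_adjointC; rewrite closureE; apply: smallest_sub; first exact: closed_adjoint.
exact: sub_adjointC.
Qed.

Lemma symmetric_sub_adjoint T : symmetric_op T <-> T `<=` adjoint T.
Proof.
split=> [sT [v v'] Tv u u' Tu|sT u u' v v' Tu Tv]; first exact: (sT _ _ _ _ Tu Tv).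
exact: (sT _ Tv).
Qed.

Lemma closure_sub_adjoint T : symmetric_op T -> closure T `<=` adjoint T.
Proof.
move=> /symmetric_sub_adjoint sT; rewrite closureE.
by apply: smallest_sub => //; exact: closed_adjoint.
Qed.

Lemma closure_symmetric T : symmetric_op T -> symmetric_op (closure T).
Proof.
by move=> sT; apply/symmetric_sub_adjoint; rewrite adjoint_closure;
  exact: closure_sub_adjoint.
Qed.

Lemma nonnegative_opP T :
  nonnegative_op T <-> T `<=` [set p | 0 <= inner p.2 p.1].
Proof.
split=> [h [u v] Tuv|h u v w uv Tuw].
  by have := h u (0 *: u) v erefl Tuv; rewrite innerZl mul0r.
by rewrite (uv : v = 0 *: u) innerZl mul0r; exact: h _ Tuw.
Qed.

Lemma closure_nonnegative T : nonnegative_op T -> nonnegative_op (closure T).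
Proof.
move=> /nonnegative_opP nT; apply/nonnegative_opP; rewrite closureE.
apply: smallest_sub => //; apply: closed_nneg => p.
have -> : (fun p : H * H => inner p.2 p.1) = fun p => inner p.1 p.2.
  by apply/funext => q; rewrite innerC.
exact: inner_continuous.
Qed.

Lemma closure_densely_defined T : densely_defined T -> densely_defined (closure T).
Proof. by apply: dense_subset => u [v uv]; exists v; exact: subset_closure. Qed.

(** The closure lies in the adjoint, which is single-valued because the domain is
dense; so the closure is single-valued too. *)
Lemma closure_linear_operator T : linear_subspace T -> densely_defined T ->
  symmetric_op T -> linear_operator (closure T).
Proof.
move=> sT dT symT; have [T0 TD] := closure_linear_subspace sT.
split=> [//|a u v u' v' Tu Tu'|u v v' Tv Tv']; first exact: (TD a (u, v) (u', v')).
apply/eqP; rewrite -subr_eq0; apply/eqP.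
apply: (dense_orthogonal dT) => a [a' Ta]; rewrite innerBr.
have := closure_sub_adjoint symT Tv Ta.
by have := closure_sub_adjoint symT Tv' Ta => /= <- <-; rewrite subrr.
Qed.

(** For (w, k) in the adjoint, solve (T + 1) u = w + k in the closure of T. Then
w - u is an eigenvector of the adjoint for the eigenvalue -1, so w = u. *)
Lemma closure_self_adjoint T : linear_subspace T -> densely_defined T ->
  symmetric_op T -> nonnegative_op T ->
  (forall w, adjoint T (w, - w) -> w = 0) -> self_adjoint (closure T).
Proof.
move=> sT dT symT /nonnegative_opP nT defT.
split; first exact: closure_densely_defined.
rewrite adjoint_closure; apply/seteqP; split; last exact: closure_sub_adjoint.
(* The graph of T + 1: it is bounded below because T is nonnegative, and an
   element orthogonal to its range is an eigenvector of the adjoint for -1. *)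
pose T1 := [set p : H * H | T (p.1, p.2 - p.1)].
have sT1 : linear_subspace T1.
  case: sT => T0 TD; split=> [|a [u v] [u' v'] Tu Tu']; first by rewrite /T1 /= subr0.
  change (T (a *: u + u', a *: v + v' - (a *: u + u'))).
  rewrite opprD addrACA -scalerBr.
  exact: (TD a (u, v - u) (u', v' - u')).
have onto : forall h, exists u, closure T1 (u, h).
  apply: (@bounded_below_onto _ _ _ 1) => // [u v /nT /=|d dp].
    rewrite mul1r innerBl subr_ge0 inner_normE => uv.
    have [->|u0] := eqVneq u 0; first by rewrite normr0.
    have up : 0 < `|u| by rewrite normr_gt0.
    rewrite -(ler_pM2r up) -expr2; apply: le_trans uv _.
    by apply: le_trans (ler_norm _) (cauchy_schwarz _ _).
  apply: defT => u v uv /=.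
  have := dp u (v + u); rewrite /T1 /= addrK => /(_ uv).
  by rewrite innerDl innerNr => /eqP; rewrite addr_eq0 => /eqP.
move=> [w k] Twk; have [u Tu] := onto (k + w).
have Tu' : closure T (u, k + w - u).
  apply/closure_normP => e e0.
  have [[a b] Tab] := (closure_normP _ _).1 Tu (e / 2) (divr_gt0 e0 (ltr0n _ 2)).
  rewrite prod_normE /= gt_max => /andP[ua kb].
  exists (a, b - a) => //; rewrite prod_normE /= gt_max; apply/andP; split; first lra.
  have -> : k + w - u - (b - a) = (k + w - b) - (u - a).
    by rewrite !opprB addrACA [RHS]addrACA; congr (_ + _); rewrite addrC.
  apply: le_lt_trans (ler_normB _ _) _; lra.
have Auk := closure_sub_adjoint symT Tu'.
(* w - u is an eigenvector of the adjoint for -1 as well. *)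
suff wu : w = u by move: Tu'; rewrite -wu addrK.
apply/eqP; rewrite -subr_eq0; apply/eqP/defT => a a' Taa'.
have := Twk _ _ Taa'; have := Auk _ _ Taa' => /=.
rewrite !(innerBr, innerNr, innerDr) => -> ->; ring.
Qed.

(** If T equals its adjoint, then <T w, w> = - |w|^2 contradicts nonnegativity. If
T is bounded, take v in the domain close to w: <T v, v> is then close to
<T v, w> = - <v, w>, which is close to - |w|^2. *)
Lemma negative_adjoint T w : densely_defined T -> nonnegative_op T ->
  adjoint T (w, - w) -> w != 0 -> ~ bounded_op T /\ ~ self_adjoint T.
Proof.
move=> dT /nonnegative_opP nT Tw w0.
have wp : 0 < `|w| by rewrite normr_gt0.
split=> [[M TM]|[_ eT]]; last first.
  move: Tw; rewrite eT => /nT /=; rewrite innerNl oppr_ge0 inner_normE.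
  by rewrite leNgt exprn_gt0.
pose M' := `|M| + 1.
have M'0 : 0 < M' by rewrite ltr_wpDl.
(* The final estimate is |w|^2 <= e |w| + 2 M' e |w|; this e makes the right
   side equal to |w| (|w| - e). *)
pose e := `|w| / (2 * (M' + 1)).
have e0 : 0 < e by rewrite divr_gt0// mulr_gt0// addr_gt0.
have eM : e * M' + e = `|w| / 2 by rewrite /e; field; rewrite gt_eqF// addr_gt0.
have [v [v' Tv] wv] := (closure_normP _ _).1 ((dense_closureP _).1 dT w) e e0.
have v'M : `|v'| <= M' * `|v|.
  by apply: le_trans (TM _ _ Tv) _; rewrite ler_wpM2r// ler_wpDr// ler_norm.
have pos : 0 <= inner v' v by exact: (nT _ Tv).
have neg : inner v' w = - inner v w by rewrite (Tw _ _ Tv) /= innerNr.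
(* |w|^2 = <w - v, w> + <v, w>, where <v, w> = - <v', w - v> - <v', v> is at
   most - <v', w - v>, since T is nonnegative. *)
have h1 := le_trans (ler_norm _) (cauchy_schwarz (w - v) w).
have h2 : - (`|v'| * `|w - v|) <= inner v' (w - v).
  by have := cauchy_schwarz v' (w - v); rewrite ler_norml => /andP[].
have v2w : `|v| <= 2 * `|w|.
  have -> : v = w - (w - v) by rewrite opprB addrC subrK.
  by apply: le_trans (ler_normB _ _) _; have := mulr_ge0 (ltW e0) (ltW M'0); lra.
have h3 : `|v'| * `|w - v| <= (M' * (2 * `|w|)) * e.
  apply: ler_pM => //; last exact: ltW.
  by apply: le_trans v'M _; rewrite ler_wpM2l// ltW.
have h4 : `|w - v| * `|w| <= e * `|w| by rewrite ler_wpM2r// ltW.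
have : `|w| ^+ 2 <= `|w| * (`|w| - e).
  have -> : `|w| - e = e + 2 * M' * e by lra.
  move: h1 h2; rewrite innerBl innerBr neg inner_normE; lra.
by rewrite expr2 ler_pM2l// lerDl oppr_ge0 leNgt e0.
Qed.

End closures.

(** * Resolvents of bounded symmetric maps *)

Section symmetric_maps.
Context {R : realType} {H : hilbertType R}.
Implicit Types (u v w d h : H).

Definition graph (p : H -> H) : set (H * H) := [set q | q.2 = p q.1].

(** A limit (u, h) of points of the graph lies in the adjoint of the graph, and
testing it against p (p u - h) gives p u = h. *)
Lemma symmetric_onto (p : H -> H) (g : R) : linear p -> 0 < g ->
  (forall u v, inner (p u) v = inner u (p v)) ->
  (forall u, g * `|u| <= `|p u|) -> forall h, exists u, p u = h.
Proof.
move=> pl g0 ps pg h.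
have p0 : p 0 = 0.
  by have := pl (-1) 0 0; rewrite scaler0 addr0 scaleN1r addNr.
have symG : symmetric_op (graph p).
  move=> u u' v v' uu vv.
  by rewrite (uu : u' = p u) (vv : v' = p v) ps.
have [||d dp|u Gu] := @bounded_below_onto _ _ (graph p) g^-1 _ _ _ h.
- split=> [|a [u u'] [v v'] uu vv]; first by rewrite /graph /= p0.
  by rewrite /graph /= (uu : u' = p u) (vv : v' = p v) pl.
- by move=> u v uv; rewrite ler_pdivlMl// (uv : v = p u).
- have pd : p d = 0.
    by apply: inner_eq0; rewrite -ps; exact: dp.
  apply/eqP; rewrite -normr_le0.
  by have := pg d; rewrite pd normr0 pmulr_rle0.
exists u; apply/eqP; rewrite -subr_eq0; apply/eqP/inner_eq0.
have /= e := closure_sub_adjoint symG Gu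
  (erefl : graph p (p u - h, p (p u - h))).
by rewrite innerBr -ps e subrr.
Qed.

Lemma graph_self_adjoint (p : H -> H) :
  (forall u v, inner (p u) v = inner u (p v)) -> self_adjoint (graph p).
Proof.
move=> ps; split.
  by move=> O [u Ou] _; exists u; split=> //; exists (p u).
apply/seteqP; split=> [[w k] wk|[w k] wk u u' uu]; last first.
  by rewrite (uu : u' = p u) (wk : k = p w) ps.
apply/eqP; rewrite -subr_eq0; apply/eqP/inner_eq0.
have /= e := wk (k - p w) (p (k - p w)) erefl.
by rewrite innerBr -ps e subrr.
Qed.

Lemma shiftedE (p : H -> H) (z : R[i]) (x y : H * H) :
  shifted (graph p) z (x, y) <->
  y.1 = complex.Re z *: x.1 - complex.Im z *: x.2 - p x.1 /\
  y.2 = complex.Re z *: x.2 + complex.Im z *: x.1 - p x.2.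
Proof.
split=> [[[v1 v2] [/= e1 e2] /= ->]|[y1 y2]].
  by rewrite (e1 : v1 = p x.1) (e2 : v2 = p x.2).
by exists (p x.1, p x.2) => //; case: y y1 y2 => ? ? /= -> ->.
Qed.

(** The cross terms of |(A + i b)(u1 + i u2)|^2 with v1 = A u1 and v2 = A u2 cancel;
the hypothesis is the symmetry of A on the pair u1, u2. *)
Lemma sqr_norm_rotation (u1 u2 v1 v2 : H) (b : R) : inner v1 u2 = inner u1 v2 ->
  `|v1 - b *: u2| ^+ 2 + `|v2 + b *: u1| ^+ 2 =
  (`|v1| ^+ 2 + b ^+ 2 * `|u1| ^+ 2) + (`|v2| ^+ 2 + b ^+ 2 * `|u2| ^+ 2).
Proof.
move=> e; rewrite -!inner_normE.
rewrite !(innerDl, innerDr, innerNl, innerNr, innerZl, innerZr) (innerC u2 v1) e.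
rewrite (innerC v2 u1); ring.
Qed.

(** With A = Re z - p and b = Im z, the product of z - p with conj z - p is the
symmetric map A^2 + b^2, which the hypothesis bounds below by g. *)
Lemma resolvent_symmetric (p : H -> H) (z : R[i]) (g : R) : linear p -> 0 < g ->
  (forall u v, inner (p u) v = inner u (p v)) ->
  (forall u, g * `|u| ^+ 2 <=
     `|complex.Re z *: u - p u| ^+ 2 + complex.Im z ^+ 2 * `|u| ^+ 2) ->
  resolvent_set (graph p) z.
Proof.
case: z => a b /= pl g0 ps pg.
have [A AE] : exists A : H -> H, forall u, A u = a *: u - p u by eexists.
have Alin : linear A.
  by move=> k u v; rewrite !AE pl scalerDr scalerBr !scalerA mulrC opprD addrACA.
have As u v : inner (A u) v = inner u (A v).
  by rewrite !AE innerBl innerBr innerZl innerZr ps.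
have {}pg u : g * `|u| ^+ 2 <= `|A u| ^+ 2 + b ^+ 2 * `|u| ^+ 2 by rewrite AE.
pose B u := A (A u) + b ^+ 2 *: u.
have Blin : linear B.
  move=> k u v; rewrite /B !Alin !scalerDr !scalerA [k * _]mulrC addrACA.
  by [].
have Bs u v : inner (B u) v = inner u (B v).
  by rewrite /B innerDl innerDr innerZl innerZr !As.
have Bg u : g * `|u| <= `|B u|.
  have [->|u0] := eqVneq u 0; first by rewrite normr0 mulr0.
  have up : 0 < `|u| by rewrite normr_gt0.
  rewrite -(ler_pM2r up) -mulrA -expr2; apply: le_trans (pg u) _.
  apply: le_trans (le_trans (ler_norm _) (cauchy_schwarz _ _)).
  by rewrite /B innerDl As innerZl !inner_normE.
have onto := symmetric_onto Blin g0 Bs Bg.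
have Ap x y : shifted (graph p) (a +i* b)%C (x, y) <->
    y.1 = A x.1 - b *: x.2 /\ y.2 = A x.2 + b *: x.1.
  rewrite shiftedE !AE /=; rewrite addrAC [_ + _ - p _]addrAC.
  by rewrite [a *: x.1 - _ - _]addrAC.
have key x y : shifted (graph p) (a +i* b)%C (x, y) ->
    g * (`|x.1| ^+ 2 + `|x.2| ^+ 2) <= `|y.1| ^+ 2 + `|y.2| ^+ 2.
  move=> /Ap[-> ->]; rewrite sqr_norm_rotation ?As//.
  by rewrite mulrDr lerD// pg.
have bound x y : shifted (graph p) (a +i* b)%C (x, y) ->
    `|x| <= Num.sqrt (2 / g) * `|y|.
  move=> xy; have := key _ _ xy; rewrite -ler_pdivlMl// => h.
  have x1 : `|x.1| <= Num.sqrt (`|x.1| ^+ 2 + `|x.2| ^+ 2).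
    by rewrite -{1}[ `|x.1|]ger0_norm// -sqrtr_sqr ler_wsqrtr// lerDl sqr_ge0.
  have x2 : `|x.2| <= Num.sqrt (`|x.1| ^+ 2 + `|x.2| ^+ 2).
    by rewrite -{1}[ `|x.2|]ger0_norm// -sqrtr_sqr ler_wsqrtr// lerDr sqr_ge0.
  have y1 : `|y.1| <= `|y| by rewrite prod_normE le_max lexx.
  have y2 : `|y.2| <= `|y| by rewrite prod_normE le_max lexx orbT.
  apply: (@le_trans _ _ (Num.sqrt (`|x.1| ^+ 2 + `|x.2| ^+ 2))).
    by rewrite prod_normE ge_max x1.
  have -> : Num.sqrt (2 / g) * `|y| = Num.sqrt (2 / g * `|y| ^+ 2).
    by rewrite [RHS]sqrtrM ?divr_ge0 ?(ltW g0)// sqrtr_sqr normr_id.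
  apply: ler_wsqrtr; apply: le_trans h _.
  rewrite mulrC [2 / g]mulrC -mulrA [2 * _]mulrC.
  have := lerD (_ : `|y.1| ^+ 2 <= `|y| ^+ 2) (_ : `|y.2| ^+ 2 <= `|y| ^+ 2).
  rewrite !ler_pXn2r ?nnegrE// => /(_ y1 y2) hy.
  by rewrite mulrC ler_wpM2l ?invr_ge0 ?(ltW g0)//; lra.
have inj x x' y : shifted (graph p) (a +i* b)%C (x, y) ->
    shifted (graph p) (a +i* b)%C (x', y) -> x = x'.
  move=> /Ap[x1 x2] /Ap[x1' x2'].
  have AB u v : A (u - v) = A u - A v by rewrite addrC -scaleN1r Alin addrC scaleN1r.
  have /bound : shifted (graph p) (a +i* b)%C (x - x', 0).
    apply/Ap => /=; rewrite !AB !scalerBr; split.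
      by rewrite opprD addrACA -opprD -x1 -x1' subrr.
    by rewrite addrACA -x2 -opprD -x2' subrr.
  by rewrite normr0 mulr0 normr_le0 subr_eq0 => /eqP.
split=> [y|]; last by exists (Num.sqrt (2 / g)).
have [r1 r1y] := onto y.1; have [r2 r2y] := onto y.2.
(* With r1 + i r2 = (A^2 + b^2)^-1 y this pair is (conj z - p)(r1 + i r2). *)
pose r := (A r1 + b *: r2, A r2 - b *: r1).
have ry : shifted (graph p) (a +i* b)%C (r, y).
  apply/Ap => /=; rewrite -r1y -r2y /= /B.
  have AD u v k : A (u + k *: v) = A u + k *: A v.
    by rewrite addrC Alin addrC.
  have AB u v k : A (u - k *: v) = A u - k *: A v by rewrite -!scaleNr AD.
  rewrite AD AB scalerBr scalerDr !scalerA -!expr2; split; last by rewrite subrKA.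
  by rewrite opprB [RHS]addrACA subrr addr0.
by exists r; split=> // x; exact: inj.
Qed.

Lemma spectrum_contraction (p : H -> H) : linear p ->
  (forall u v, inner (p u) v = inner u (p v)) -> (forall u, `|p u| <= `|u|) ->
  spectrum (graph p) `<=` [set x%:C%C | x in `[-1, 1]%classic].
Proof.
move=> pl ps pc z zs; apply: contrapT => zn; apply: zs.
have [b0|b0] := eqVneq (complex.Im z) 0; last first.
  apply: (@resolvent_symmetric p z (complex.Im z ^+ 2)) => // [|u].
    by rewrite lt_def sqrf_eq0 b0 sqr_ge0.
  by rewrite lerDr sqr_ge0.
have a1 : 1 < `|complex.Re z|.
  rewrite ltNge; apply/negP; rewrite ler_norml => ha; apply: zn.
  exists (complex.Re z); first by rewrite /= in_itv.
  by case: z b0 {ha} => a b /= ->.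
apply: (@resolvent_symmetric p z ((`|complex.Re z| - 1) ^+ 2)) => // [|u].
  by rewrite exprn_gt0// subr_gt0.
rewrite b0 expr0n mul0r addr0 -exprMn ler_pXn2r ?nnegrE ?mulr_ge0 ?subr_ge0 ?(ltW a1)//.
rewrite mulrBl mul1r; apply: le_trans (lerB_dist _ _).
by rewrite normrZ lerB.
Qed.

End symmetric_maps.

(** * The Gauss-Green identity *)

Section finite_support.
Context {R : realType} {I : choiceType}.
Implicit Types (f : I -> R) (A : set I).

Let nneg_finite f A : finite_set A -> (forall i, 0 <= f i) ->
  (forall i, ~ A i -> f i = 0) ->
  fine (\esum_(i in [set: I]) (f i)%:E) = \sum_(i \in A) f i.
Proof.
move=> Af f0 fA; rewrite (esumID A); last by move=> i _; rewrite lee_fin.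
rewrite !setTI [X in (_ + X)%E]esum1 => [|i /fA -> //].
rewrite adde0 esum_fset// => [|i _]; last by rewrite lee_fin.
by rewrite !fsbig_finite//= sumEFin.
Qed.

Lemma ssum_finite f A : finite_set A -> (forall i, ~ A i -> f i = 0) ->
  ssum f = \sum_(i \in A) f i.
Proof.
move=> Af fA; rewrite /ssum !(@nneg_finite _ A)//; first last.
- by move=> i /fA fi; rewrite /funrpos fi maxxx.
- by move=> i /fA fi; rewrite /funrneg fi oppr0 maxxx.
rewrite !fsbig_finite//= -sumrB; apply: eq_bigr => i _.
by rewrite -[in RHS](funrposBneg f).
Qed.

Lemma wdot_indicator (w u : I -> R) x :
  wdot w (fun y => (y == x)%:R) u = w x * u x.
Proof.
rewrite /wdot (@ssum_finite _ [set x]); [|exact: finite_set1|].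
  by rewrite fsbig_set1 eqxx mulr1.
by move=> i /= /eqP/negbTE ->; rewrite mulr0 mul0r.
Qed.

End finite_support.

Section green.
Context {R : realType} (N : network R).
Implicit Types (x y o : N) (f g : N -> R).

Lemma cond_eq0 x y : ~~ adj x y -> cond x y = 0.
Proof. by rewrite -cond_gt0 lt_def cond_ge0 andbT negbK => /eqP. Qed.

Lemma cond_le_total_cond x y : adj x y -> cond x y <= total_cond x.
Proof.
move=> xy; rewrite /total_cond (fsbigD1 y)//=; last exact: adj_locally_finite.
by rewrite lerDl fsumr_ge0// => z _; exact: cond_ge0.
Qed.

Lemma laplacianP a f g x :
  laplacian (fun y => a * f y + g y) x = a * laplacian f x + laplacian g x.
Proof.
rewrite /laplacian !fsbig_finite/=; try exact: adj_locally_finite.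
by rewrite mulr_sumr -big_split; apply: eq_bigr => y _ /=; ring.
Qed.

Lemma laplacian_constant f x : (forall y, f y = f x) -> laplacian f x = 0.
Proof. by move=> fc; rewrite /laplacian fsbig1// => y _; rewrite fc subrr mulr0. Qed.

Definition indicator x : N -> R := fun y => (y == x)%:R.

(** The directed edges at [x], which carry the energy of [indicator x]. *)
Definition star x : set (N * N) :=
  [set (x, y) | y in [set y | adj x y]] `|` [set (y, x) | y in [set y | adj x y]].

Lemma finite_star x : finite_set (star x).
Proof.
by rewrite finite_setU; split; apply: finite_image; exact: adj_locally_finite.
Qed.

Lemma indicator_edge x p : ~ star x p ->
  cond2 p * edge_diff (indicator x) p = 0.
Proof.
case: p => y z npx; rewrite /cond2 /edge_diff /indicator /=.
have [yz|/cond_eq0 ->] := boolP (adj y z); last by rewrite mul0r.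
have [yx|yx] := eqVneq y x.
  by case: npx; left; exists z; rewrite -yx.
have [zx|zx] := eqVneq z x; last by rewrite subrr mulr0.
by case: npx; right; exists y; rewrite -zx //= adjC.
Qed.

Lemma indicator_finite_energy x : finite_energy (indicator x).
Proof.
apply: abs_summable_finite (finite_star x) _ => p /indicator_edge.
by rewrite expr2 mulrA => ->; rewrite mul0r.
Qed.

Definition edelta x : fin_energy N := mk_fin_energy (indicator_finite_energy x).

(** Each edge at x occurs twice in the double sum, once in each direction, which
cancels the factor 1/2 of the energy. *)
Lemma energy_indicator f x : energy f (indicator x) = laplacian f x.
Proof.
rewrite /energy /wdot (@ssum_finite _ _ _ (star x)); [|exact: finite_star|]; last first.
  by move=> p /indicator_edge h; rewrite mulrAC h mul0r.
have fin := adj_locally_finite x.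
rewrite fsbigU0; [|exact: finite_image|exact: finite_image|]; last first.
  move=> p /= [[y xy <-] [z xz [zx yx]]].
  by move: xy; rewrite -yx adjxx.
rewrite !fsbig_image; [|by move=> y z _ _ []|by move=> y z _ _ []].
have e1 : \sum_(y \in [set y | adj x y])
    cond2 (x, y) * edge_diff f (x, y) * edge_diff (indicator x) (x, y) = laplacian f x.
  apply: eq_fsbigr => y /set_mem /= xy.
  rewrite /cond2 /edge_diff /indicator /= eqxx (_ : (y == x) = false).
    by rewrite subr0 mulr1.
  by apply/negbTE/eqP => yx; move: xy; rewrite yx adjxx.
have e2 : \sum_(y \in [set y | adj x y])
    cond2 (y, x) * edge_diff f (y, x) * edge_diff (indicator x) (y, x) = laplacian f x.
  apply: eq_fsbigr => y /set_mem /= xy.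
  rewrite /cond2 /edge_diff /indicator /= eqxx (_ : (y == x) = false).
    by rewrite condC sub0r mulrN1 -mulrN opprB.
  by apply/negbTE/eqP => yx; move: xy; rewrite yx adjxx.
by rewrite e1 e2 /=; lra.
Qed.

Lemma inner_eclass (f g : fin_energy N) : inner (eclass f) (eclass g) = energy f g.
Proof. exact: energy_innerE. Qed.

(** Evaluating the Laplacian is taking an inner product with a fixed vector; linear
identities for Laplacians of energy classes follow from this. *)
Lemma inner_edelta (q : energy_space N) x :
  inner q (eclass (edelta x)) = laplacian (repr q) x.
Proof. by rewrite -[in LHS](eclass_repr q) inner_eclass energy_indicator. Qed.

Lemma laplacian_repr (f : fin_energy N) : laplacian (repr (eclass f)) = laplacian f.
Proof. by apply/funext => x; rewrite -inner_edelta inner_eclass energy_indicator. Qed.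

(** <v_x, delta_y> is the Laplacian of v_x at y by Green's identity, and
delta_y(x) - delta_y(o) by the reproducing property. *)
Lemma laplacian_dipole o x y :
  laplacian (repr (dipole o x)) y = indicator x y - indicator o y.
Proof.
rewrite -inner_edelta dipoleP potential_diffE /= /indicator.
by rewrite (eq_sym x) (eq_sym o).
Qed.

End green.

(** * The Laplacian on the energy space *)

Section energy_operator.
Context {R : realType} (N : network R).
Implicit Types (x y o : N).

Lemma laplacian_linear (V : lmodType R) (F : V -> N -> R) :
  (forall a (u v : V) x, F (a *: u + v) x = a * F u x + F v x) ->
  forall a u v x, laplacian (F (a *: u + v)) x =
    a * laplacian (F u) x + laplacian (F v) x.
Proof.
move=> FD a u v x; rewrite -laplacianP.
by congr laplacian; apply/funext => y; rewrite FD.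
Qed.

Lemma fin_energyPE a (f g : fin_energy N) x : (a *: f + g) x = a * f x + g x.
Proof. by []. Qed.

Lemma ell2PE a (f g : ell2 N) x : (a *: f + g) x = a * f x + g x.
Proof. by []. Qed.

Lemma laplacian_energy_core_linear o : linear_subspace (laplacian_energy_core o).
Proof.
have [L0 LD] := lspan_linear_subspace (dipole o).
split=> [|a [v w] [v' w']].
  split=> //=; exists 0, 0.
  have e0 : eclass (0 : fin_energy N) = 0 by rewrite -(scale0r 0) eclassZ scale0r.
  split=> //.
  by apply/funext => x; rewrite laplacian_constant.
move=> [/= Lv [f [g [fv gw gf]]]] [/= Lv' [f' [g' [fv' gw' gf']]]].
split=> /=; first exact: LD.
exists (a *: f + f'), (a *: g + g'); split.
- by rewrite eclassD eclassZ fv fv'.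
- by rewrite eclassD eclassZ gw gw'.
by apply/funext => x; rewrite (laplacian_linear fin_energyPE) -gf -gf'.
Qed.

Lemma laplacian_energy_core_dipole o x :
  laplacian_energy_core o (dipole o x, eclass (edelta x - edelta o)).
Proof.
split; first exact: lspan_gen.
exists (repr (dipole o x)), (edelta x - edelta o); split=> //.
  by rewrite eclass_repr.
by apply/funext => y; rewrite laplacian_dipole.
Qed.

Lemma laplacian_energy_core_fun o v w w' : laplacian_energy_core o (v, w) ->
  laplacian_energy_core o (v, w') -> w = w'.
Proof.
move=> [_ [f [g [/= fv <- gf]]]] [_ [f' [g' [/= fv' <- gf']]]].
congr eclass; apply/val_inj => /=.
by rewrite gf gf' -laplacian_repr fv -fv' laplacian_repr.
Qed.

Lemma dom_linear_subspace (H : hilbertType R) (T : set (H * H)) :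
  linear_subspace T -> linear_subspace (dom T).
Proof.
move=> [T0 TD]; split=> [|a u v [u' uu] [v' vv]]; first by exists 0.
by exists (a *: u' + v'); exact: TD _ (u, u') (v, v') uu vv.
Qed.

Lemma dom_laplacian_energy_core o : dom (laplacian_energy_core o) = lspan (dipole o).
Proof.
apply/seteqP; split=> [v [w []]//|].
apply: lspan_min; first exact/dom_linear_subspace/laplacian_energy_core_linear.
by move=> x; exists (eclass (edelta x - edelta o)); exact: laplacian_energy_core_dipole.
Qed.

Lemma lspan_dipole_dense o : dense (lspan (dipole o)).
Proof.
apply: orthogonal_dense; first exact: lspan_linear_subspace.
move=> d dp; rewrite -[d]eclass_repr.
have -> : 0 = eclass (0 *: repr d) by rewrite eclassZ scale0r.
have dx x : repr d x = repr d o.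
  apply/eqP; rewrite -subr_eq0; apply/eqP.
  by have := dp _ (lspan_gen (dipole o) x); rewrite dipoleP.
apply/eclass_eq; rewrite edge_diffZ; apply/funext => p.
by rewrite /edge_diff !dx subrr mul0r.
Qed.

Lemma laplacian_energy_core_dense o : densely_defined (laplacian_energy_core o).
Proof. by rewrite /densely_defined dom_laplacian_energy_core; exact: lspan_dipole_dense. Qed.

(** Applied with (f, g) in the core this is the symmetry of the core. Applied with
an arbitrary eigenfunction of finite energy it provides eigenvectors of the
adjoint. On a dipole both sides are equal to (Delta f)(x) - (Delta f)(o). *)
Lemma laplacian_energy_adjoint o (f g : fin_energy N) :
  g = laplacian f :> (N -> R) ->
  adjoint (laplacian_energy_core o) (eclass f, eclass g).
Proof.
move=> gf.
have : lspan (dipole o) `<=` dom (laplacian_energy_core o `&`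
    [set p | inner p.2 (eclass f) = inner p.1 (eclass g)]).
  have [T0 TD] := laplacian_energy_core_linear o.
  apply: lspan_min; first apply: dom_linear_subspace.
    split=> [|a p q [Tp pE] [Tq qE]]; first by split=> //=; rewrite !inner0l.
    by split; [exact: TD|rewrite /= !innerDl !innerZl pE qE].
  move=> x; exists (eclass (edelta x - edelta o)).
  split; first exact: laplacian_energy_core_dipole.
  rewrite /= dipoleP potential_diffE gf.
  rewrite -scaleN1r addrC eclassD eclassZ innerDl innerZl mulN1r.
  rewrite ![inner _ (eclass f)]innerC !inner_edelta laplacian_repr.
  by rewrite addrC.
move=> sub v w vw /=; have [//|w' [vw' /= wE]] := sub v.
  by case: vw.
by rewrite (laplacian_energy_core_fun vw vw').
Qed.

Lemma laplacian_energy_core_symmetric o : symmetric_op (laplacian_energy_core o).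
Proof.
apply/symmetric_sub_adjoint => -[v w] [/= _ [f [g [<- <- gf]]]].
exact: laplacian_energy_adjoint.
Qed.

(** Sum [energy_indicator] over the support of u. Here h ranges over all functions
of finite energy, and these need not be square summable. *)
Lemma green_finite (u : ell2 N) : lspan (@delta R N) u ->
  exists2 f : fin_energy N, f = u :> (N -> R) &
    forall (h : fin_energy N) (k : ell2 N), k = laplacian h :> (N -> R) ->
      inner (eclass h) (eclass f) = inner k u.
Proof.
move: u; apply: lspan_min; first split.
- exists 0 => // h k _; rewrite inner0r.
  have -> : (0 : fin_energy N) = 0 *: 0 by rewrite scale0r.
  by rewrite eclassZ innerZr mul0r.
- move=> a u u' [f fu fh] [f' fu' fh']; exists (a *: f + f').
    by apply/funext => x; rewrite ell2PE fin_energyPE fu fu'.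
  by move=> h k kh; rewrite eclassD eclassZ !innerDr !innerZr (fh _ _ kh) (fh' _ _ kh).
move=> x; exists (edelta x) => // h k kh.
rewrite inner_edelta laplacian_repr -kh.
by rewrite innerC [RHS](wdot_indicator _ k x) mul1r.
Qed.

(** The Laplacian of a combination of dipoles has finite support, hence can be
compared with elements of l^2(V). *)
Lemma laplacian_energy_core_finite o v : lspan (dipole o) v ->
  exists2 u : ell2 N, lspan (@delta R N) u & u = laplacian (repr v) :> (N -> R).
Proof.
have [L0 LD] := lspan_linear_subspace (@delta R N).
move: v; apply: lspan_min; first split.
- exists 0 => //; apply/funext => x.
  by rewrite -inner_edelta inner0l.
- move=> a v v' [u Lu uv] [u' Lu' uv']; exists (a *: u + u'); first exact: LD.
  apply/funext => x.
  by rewrite ell2PE uv uv' -!inner_edelta innerDl innerZl.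
move=> x; exists (-1 *: delta o + delta x); first by apply: LD; exact: lspan_gen.
apply/funext => y; rewrite laplacian_dipole ell2PE /indicator.
by rewrite mulN1r addrC.
Qed.

(** <Delta f, f> is the sum of the squares of Delta f, by [green_finite] applied to
the finitely supported function Delta f itself. *)
Lemma laplacian_energy_core_nonnegative o :
  nonnegative_op (laplacian_energy_core o).
Proof.
apply/nonnegative_opP => -[v w] [/= Lv [f [g [fv <- gf]]]].
have [u Lu uf] := laplacian_energy_core_finite Lv.
move: uf; rewrite -fv laplacian_repr => uf.
have [h hu hE] := green_finite Lu.
have -> : g = h by apply/val_inj; rewrite /= gf hu.
by rewrite innerC (hE f u uf) inner_ge0.
Qed.

End energy_operator.

(** * The Laplacian on l^2(V) *)

Section l2_laplacian.
Context {R : realType} (N : network R).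
Implicit Types (x y o : N).

Lemma inner_delta (u : ell2 N) x : inner (delta x) u = u x.
Proof. by rewrite [LHS](wdot_indicator _ u x) mul1r. Qed.

Lemma lspan_delta_dense : dense (lspan (@delta R N)).
Proof.
apply: orthogonal_dense; first exact: lspan_linear_subspace.
move=> d dp; apply/val_inj/funext => x /=.
by rewrite -inner_delta dp//; exact: lspan_gen.
Qed.

Lemma laplacian_ell2_core_linear : linear_subspace (@laplacian_ell2_core R N).
Proof.
have [L0 LD] := lspan_linear_subspace (@delta R N).
split=> [|a [v w] [v' w'] [/= Lv wv] [/= Lv' wv']].
  by split=> //=; apply/funext => x; rewrite laplacian_constant.
split=> /=; first exact: LD.
by apply/funext => x; rewrite (laplacian_linear (@ell2PE R N)) -wv -wv'.
Qed.

Lemma laplacian_ell2_core_dense : densely_defined (@laplacian_ell2_core R N).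
Proof. by rewrite /densely_defined dom_laplacian_ell2_core; exact: lspan_delta_dense. Qed.

Lemma sum_cond_indicator x y :
  \sum_(z \in [set z | adj y z]) cond y z * indicator x z = cond y x.
Proof.
have fin := adj_locally_finite y.
have [yx|yx] := boolP (adj y x); last first.
  rewrite fsbig1 ?cond_eq0// => z /= yz; rewrite /indicator.
  have [zx|_] := eqVneq z x; last by rewrite mulr0.
  by rewrite -zx yz in yx.
rewrite (fsbigD1 x)//= fsbig1 => [|z [_ /eqP/negbTE zx]].
  by rewrite addr0 /indicator eqxx mulr1.
by rewrite /indicator zx mulr0.
Qed.

Lemma laplacianE (f : N -> R) x :
  laplacian f x = total_cond x * f x - \sum_(y \in [set y | adj x y]) cond x y * f y.
Proof.
have fin := adj_locally_finite x.
rewrite /laplacian /total_cond !fsbig_finite//= mulr_suml -sumrB.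
by apply: eq_bigr => y _; rewrite mulrBr.
Qed.

Lemma laplacian_indicator x y :
  laplacian (indicator x) y = total_cond y * indicator x y - cond y x.
Proof. by rewrite laplacianE sum_cond_indicator. Qed.

(** Laplacians of delta functions detect Delta u(x) for every u in l^2(V), also when
Delta u is not square summable; this identifies the adjoint. *)
Lemma laplacian_ell2_core_delta x : exists2 k : ell2 N,
  laplacian_ell2_core (delta x, k) & forall u : ell2 N, inner k u = laplacian u x.
Proof.
have [k xk] : dom (@laplacian_ell2_core R N) (delta x).
  by rewrite dom_laplacian_ell2_core; exact: lspan_gen.
exists k => // u; case: xk => /= _ kE.
have {}kE y : k y = total_cond y * indicator x y - cond x y.
  by rewrite kE condC -laplacian_indicator.
have fin := adj_locally_finite x.
rewrite [LHS](@ssum_finite _ _ _ ([set x] `|` [set y | adj x y])); first last.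
- move=> y /= /not_orP[/eqP/negbTE yx /negP/cond_eq0 xy].
  by rewrite kE /indicator yx xy mulr0 subr0 mulr0 mul0r.
- by rewrite finite_setU; split=> //; exact: finite_set1.
rewrite fsbigU0//; last first.
  by move=> y [/= ->]; rewrite adjxx.
rewrite fsbig_set1 laplacianE kE /indicator eqxx (@cond_eq0 _ _ x x) ?adjxx//=.
rewrite mulr1 subr0 mul1r !fsbig_finite//= -sumrN; congr (_ + _).
apply: eq_big_seq => y; rewrite in_fset_set// => /set_mem /= xy.
rewrite kE /indicator (_ : (y == x) = false) ?mulr0 ?sub0r ?mul1r ?mulNr//.
by apply/negbTE/eqP => yx; move: xy; rewrite yx adjxx.
Qed.

Lemma laplacian_ell2_core_adjoint (u w : ell2 N) :
  adjoint (@laplacian_ell2_core R N) (u, w) -> w = laplacian u :> (N -> R).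
Proof.
move=> uw; apply/funext => x; have [k xk ku] := laplacian_ell2_core_delta x.
by rewrite -inner_delta -ku (uw _ _ xk).
Qed.

Lemma laplacian_ell2_core_symmetric : symmetric_op (@laplacian_ell2_core R N).
Proof.
apply/symmetric_sub_adjoint => -[u w] [/= _ wu].
have [T0 TD] := laplacian_ell2_core_linear.
have : lspan (@delta R N) `<=` dom (@laplacian_ell2_core R N `&`
    [set p | inner p.2 u = inner p.1 w]).
  apply: lspan_min; first apply: dom_linear_subspace.
    split=> [|a p q [Tp pE] [Tq qE]]; first by split=> //=; rewrite !inner0l.
    by split; [exact: TD|rewrite /= !innerDl !innerZl pE qE].
  move=> x; have [k xk ku] := laplacian_ell2_core_delta x.
  by exists k; split=> //=; rewrite ku inner_delta wu.
move=> sub v v' vv /=; have [|k [[_ /= kE] /= kw]] := sub v; first by case: vv.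
case: vv => /= _ vE.
have -> : v' = k by apply/val_inj; exact: etrans vE (esym kE).
exact: kw.
Qed.

Lemma laplacian_ell2_core_nonnegative : nonnegative_op (@laplacian_ell2_core R N).
Proof.
apply/nonnegative_opP => -[u w] [/= Lu wu].
have [f fu fE] := green_finite Lu.
by rewrite -(fE f w) ?fu// inner_ge0.
Qed.

(** Otherwise the sum of u^2 would have arbitrarily many terms that are at least
e^2. *)
Lemma ell2_large_finite (u : ell2 N) (e : R) : 0 < e ->
  finite_set [set x | e <= u x].
Proof.
move=> e0; apply: contrapT => Ainf.
have u0 x : 0 <= (u x) ^+ 2 by exact: sqr_ge0.
have us : abs_summable (fun x => u x ^+ 2).
  have := wl2P u; rewrite /sq_summable; congr abs_summable.
  by apply/funext => x; rewrite /= mul1r.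
have S0 : 0 <= ssum (fun x => u x ^+ 2) by exact: ssum_ge0.
pose n := (Num.truncn (ssum (fun x => u x ^+ 2) / e ^+ 2)).+1.
have [B BA nB] := infinite_set_fset n Ainf.
have := ssum_ge B u0 us; apply/negP; rewrite -ltNge.
apply: (@lt_le_trans _ _ (\sum_(i <- B) e ^+ 2)).
  rewrite big_const_seq count_predT iter_addr_0 -mulr_natl.
  rewrite -ltr_pdivrMr ?exprn_gt0//.
  by apply: lt_le_trans (truncnS_gt _) _; rewrite ler_nat.
rewrite big_seq [leRHS]big_seq; apply: ler_sum => x xB.
have ux : e <= u x by exact: BA.
by rewrite ler_pXn2r ?nnegrE ?(ltW e0)// (le_trans (ltW e0)).
Qed.

(** Maximum principle: if u is positive somewhere it attains its maximum by
[ell2_large_finite], and there Delta u is nonnegative while - u is negative. *)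
Lemma laplacian_ell2_negative_eigenvector_le0 (u : ell2 N) :
  (forall x, laplacian u x = - u x) -> forall x, u x <= 0.
Proof.
move=> uE x; rewrite leNgt; apply/negP => ux.
have /finite_fsetP[F FE] := ell2_large_finite u ux.
have Fx : x \in F by have : [set` F] x by rewrite -FE /=.
pose m : F := [arg max_(i > [` Fx]%fset) u (fsval i)]%O.
have um i : i \in F -> u i <= u (fsval m).
  move=> Fi; rewrite /m; case: arg_maxP => // j _ /(_ [` Fi]%fset); exact.
have umax y : u y <= u (fsval m).
  have [uy|uy] := leP (u x) (u y); last exact: le_trans (ltW uy) (um _ Fx).
  by apply: um; have : [set` F] y by rewrite -FE.
have : 0 <= laplacian u (fsval m).
  by apply: fsumr_ge0 => y _; rewrite mulr_ge0 ?cond_ge0// subr_ge0.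
by rewrite uE oppr_ge0 leNgt (lt_le_trans ux (umax x)).
Qed.

Lemma laplacian_ell2_self_adjoint :
  self_adjoint (laplacian_ell2 N).
Proof.
apply: closure_self_adjoint.
- exact: laplacian_ell2_core_linear.
- exact: laplacian_ell2_core_dense.
- exact: laplacian_ell2_core_symmetric.
- exact: laplacian_ell2_core_nonnegative.
have neg (u : ell2 N) : adjoint (@laplacian_ell2_core R N) (u, - u) ->
    forall x, u x <= 0.
  move=> /laplacian_ell2_core_adjoint uE.
  by apply: laplacian_ell2_negative_eigenvector_le0 => x; rewrite -uE.
move=> u uu; apply/val_inj/funext => x /=; apply/eqP.
rewrite eq_le neg//= -oppr_le0.
apply: (neg (- u)) => v v' vv /=.
by rewrite !innerNr (uu _ _ vv) /= innerNr.
Qed.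


End l2_laplacian.

(** * The Markov operator *)

Section markov_operator.
Context {R : realType} (N : network R).
Implicit Types (x y : N) (f g : N -> R).

Lemma markovE f x :
  total_cond x * Defs.markov f x = \sum_(y \in [set y | adj x y]) cond x y * f y.
Proof.
have fin := adj_locally_finite x; have cx := total_cond_gt0 x.
rewrite /Defs.markov !fsbig_finite//= mulr_sumr; apply: eq_bigr => y _.
by rewrite mulrA mulrCA mulfV ?mulr1// gt_eqF.
Qed.

Lemma markovP a f g x :
  Defs.markov (fun y => a * f y + g y) x = a * Defs.markov f x + Defs.markov g x.
Proof.
have fin := adj_locally_finite x; rewrite /Defs.markov !fsbig_finite//=.
by rewrite mulr_sumr -big_split; apply: eq_bigr => y _ /=; ring.
Qed.

(** Jensen's inequality for the square and the probabilities c_xy / c(x), from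
0 <= sum_y c_xy (f(y) - m)^2 with m the mean of f. *)
Lemma markov_jensen f x : total_cond x * Defs.markov f x ^+ 2 <=
  \sum_(y \in [set y | adj x y]) cond x y * f y ^+ 2.
Proof.
have fin := adj_locally_finite x.
move: (Defs.markov f x) (markovE f x) => m mE.
have : 0 <= \sum_(y \in [set y | adj x y]) cond x y * (f y - m) ^+ 2.
  by apply: fsumr_ge0 => y _; rewrite mulr_ge0 ?cond_ge0// sqr_ge0.
have -> : \sum_(y \in [set y | adj x y]) cond x y * (f y - m) ^+ 2 =
    \sum_(y \in [set y | adj x y]) cond x y * f y ^+ 2 -
    2 * m * \sum_(y \in [set y | adj x y]) cond x y * f y + m ^+ 2 * total_cond x.
  rewrite /total_cond !fsbig_finite//= !mulr_sumr -sumrB -big_split.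
  by apply: eq_bigr => y _ /=; ring.
by rewrite -mE => h; rewrite -subr_ge0; apply: le_trans h _;
  rewrite le_eqVlt; apply/orP; left; apply/eqP; ring.
Qed.

Lemma sum_cond_le (J : {fset N}) x : \sum_(y <- J) cond x y <= total_cond x.
Proof.
have fin := adj_locally_finite x.
have Jfin : finite_set [set` J] by exact: finite_fset.
rewrite /total_cond (@fsbig_widen _ _ _ _ _ ([set` J] `|` ([set y | adj x y] `\` [set` J]))).
- rewrite fsbigU0//; [|exact: finite_setD|by move=> y [yJ [_ /(_ yJ)]]].
  rewrite -fsbig_seq ?fset_uniq// lerDl.
  by apply: fsumr_ge0 => y _; exact: cond_ge0.
- by move=> y xy; have [yJ|yJ] := pselect ([set` J] y); [left|right].
- by move=> y [_ /negP/cond_eq0].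
Qed.

(** After [markov_jensen] and an exchange of sums, f(y)^2 gets the weight
sum_x c_yx <= c(y). *)
Lemma markov_contraction f : sq_summable (@total_cond R N) f ->
  sq_summable (@total_cond R N) (Defs.markov f) /\
  wdot (@total_cond R N) (Defs.markov f) (Defs.markov f) <= wdot (@total_cond R N) f f.
Proof.
move=> fs; rewrite !wdotE.
have c0 x : 0 <= total_cond x by rewrite ltW// total_cond_gt0.
apply: ssum_le => [x|J]; first by rewrite mulr_ge0// sqr_ge0.
pose A := \bigcup_(x in [set` J]) [set y | adj x y].
have Afin : finite_set A.
  by apply: bigcup_finite => [|x _]; [exact: finite_fset|exact: adj_locally_finite].
apply: (@le_trans _ _ (\sum_(y <- fset_set A) total_cond y * f y ^+ 2)); last first.
  by apply: ssum_ge => // y; rewrite mulr_ge0// sqr_ge0.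
apply: (@le_trans _ _ (\sum_(x <- J) \sum_(y <- fset_set A) cond x y * f y ^+ 2)).
  rewrite big_seq [leRHS]big_seq; apply: ler_sum => x xJ.
  apply: le_trans (markov_jensen f x) _.
  rewrite (@fsbig_widen _ _ _ _ _ A) ?fsbig_finite//.
  - by move=> y xy; exists x.
  - by move=> y [_ /negP/cond_eq0 /= ->]; rewrite mul0r.
rewrite exchange_big /=; apply: ler_sum => y _.
rewrite -mulr_suml ler_wpM2r ?sqr_ge0//.
by under eq_bigr do rewrite condC; exact: sum_cond_le.
Qed.

Lemma markov_sq_summable (u : ell2c N) :
  sq_summable (fun x => (total_cond_pos x)%:num) (Defs.markov u).
Proof. by have [] := markov_contraction (wl2P u). Qed.

Definition markov_map (u : ell2c N) : ell2c N := mk_wl2 (markov_sq_summable u).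

Lemma markov_map_linear : linear markov_map.
Proof. by move=> a u v; apply/val_inj/funext => x; exact: markovP. Qed.

Lemma markov_map_norm u : `|markov_map u| <= `|u|.
Proof.
rewrite -(@ler_pXn2r _ 2)// ?nnegrE// -!inner_normE.
by have [] := markov_contraction (wl2P u).
Qed.

Lemma markov_ell2cE : markov_ell2c N = graph markov_map.
Proof.
apply/seteqP; split=> -[u v] uv; first exact/val_inj.
by rewrite /markov_ell2c /= (uv : v = markov_map u).
Qed.

Lemma cdelta_sq_summable x :
  sq_summable (fun y => (total_cond_pos y)%:num) (indicator x).
Proof.
apply: (@sq_summable_finite _ _ _ _ [set x]); first exact: finite_set1.
by move=> y /= /eqP/negbTE yx; rewrite /indicator yx.
Qed.

Definition cdelta x : ell2c N := mk_wl2 (cdelta_sq_summable x).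

Lemma inner_cdelta x (u : ell2c N) : inner (cdelta x) u = total_cond x * u x.
Proof. exact: (wdot_indicator _ u x). Qed.

Lemma markov_map_cdelta x (u : ell2c N) :
  inner (markov_map u) (cdelta x) = inner u (markov_map (cdelta x)).
Proof.
rewrite innerC inner_cdelta markovE.
rewrite [RHS](@ssum_finite _ _ _ [set y | adj x y]).
- apply: eq_fsbigr => y _ /=.
  by rewrite mulrAC markovE sum_cond_indicator condC.
- exact: adj_locally_finite.
- by move=> y /negP/cond_eq0 xy /=; rewrite mulrAC markovE sum_cond_indicator condC xy mul0r.
Qed.

(** For fixed u the defect of symmetry is a bounded linear form in v; its Riesz
representative vanishes since the form is zero on all delta functions. *)
Lemma markov_map_symmetric u v : inner (markov_map u) v = inner u (markov_map v).
Proof.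
have [|||d [dE _]] := @riesz _ _ (fun v => inner (markov_map u) v - inner u (markov_map v))
    (2 * `|u|).
- move=> v1 v2; have -> : markov_map (v1 + v2) = markov_map v1 + markov_map v2.
    by have := markov_map_linear 1 v1 v2; rewrite !scale1r.
  by rewrite !innerDr; ring.
- move=> a v1; have -> : markov_map (a *: v1) = a *: markov_map v1.
    have m0 : markov_map 0 = 0.
      by apply/eqP; rewrite -normr_le0 (le_trans (markov_map_norm _))// normr0.
    by have := markov_map_linear a v1 0; rewrite m0 !addr0.
  by rewrite !innerZr; ring.
- move=> v1; apply: le_trans (ler_normB _ _) _.
  rewrite -mulrA mulr_natl mulr2n; apply: lerD; apply: le_trans (cauchy_schwarz _ _) _.
    by rewrite ler_wpM2r// markov_map_norm.
  by rewrite ler_wpM2l// markov_map_norm.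
suff d0 : d = 0 by have := dE v; rewrite d0 inner0l => /esym/eqP; rewrite subr_eq0 => /eqP.
apply/val_inj/funext => x /=; have := dE (cdelta x).
rewrite markov_map_cdelta subrr innerC inner_cdelta => /eqP.
by rewrite mulf_eq0 (gt_eqF (total_cond_gt0 x)) => /eqP.
Qed.

Lemma markov_map_abs u : `|inner (markov_map u) u| <= inner u u.
Proof.
apply: le_trans (cauchy_schwarz _ _) _.
by rewrite inner_normE expr2 ler_wpM2r// markov_map_norm.
Qed.

End markov_operator.

(** * A half-line with fast growing conductances *)

Section unboundedness.
Context {R : realType} (N : network R).
Implicit Types (x y o : N).

(** |Delta delta_x| is at least (Delta delta_x)(x) = c(x), while |delta_x| = 1. *)
Lemma laplacian_ell2_unbounded : (forall M : R, exists x : N, M < total_cond x) ->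
  ~ bounded_op (laplacian_ell2 N).
Proof.
move=> cM [M TM]; have [x] := cM M; apply/negP; rewrite -leNgt.
have [k xk _] := laplacian_ell2_core_delta x.
have kM := TM _ _ (subset_closure xk).
have d1 : `|delta x| = 1 :> R.
  apply/eqP; rewrite -sqrp_eq1//.
  by rewrite -inner_normE inner_delta [X in X == _](_ : _ = (x == x)%:R)// eqxx.
rewrite d1 mulr1 in kM; apply: le_trans kM.
have := cauchy_schwarz (delta x) k; rewrite d1 mul1r; apply: le_trans.
have kx : k x = total_cond x.
  case: xk => /= _ ->.
  by rewrite [LHS](laplacian_indicator x) /indicator eqxx mulr1 cond_eq0 ?adjxx// subr0.
by rewrite inner_delta kx ler_norm.
Qed.

(** The class of f is an eigenvector of the adjoint, and it is nonzero because f is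
not constant. *)
Lemma laplacian_energy_negative_eigenvector o (f : fin_energy N) x y :
  (forall z, laplacian f z = - f z) -> f x != f y ->
  ~ bounded_op (laplacian_energy o) /\ ~ self_adjoint (laplacian_energy o).
Proof.
move=> fE fxy; apply: (@negative_adjoint _ _ _ (eclass f)).
- exact/closure_densely_defined/laplacian_energy_core_dense.
- exact/closure_nonnegative/laplacian_energy_core_nonnegative.
- rewrite adjoint_closure.
  have -> : - eclass f = eclass (-1 *: f) by rewrite eclassZ scaleN1r.
  apply: laplacian_energy_adjoint; apply/funext => z.
  by rewrite fE -[RHS]mulN1r.
apply/eqP => f0; move/eqP: fxy; apply; apply/eqP; rewrite -subr_eq0; apply/eqP.
rewrite -(potential_diffE f x y) f0.
by rewrite -(scale0r (eclass f)) -eclassZ potential_diffE /= -[LHS]/(0 * f x - 0 * f y) !mul0r subrr.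
Qed.

Lemma finite_energy_local (f : N -> R) :
  abs_summable (fun x => \sum_(y \in [set y | adj x y]) cond x y * (f x - f y) ^+ 2) ->
  finite_energy f.
Proof.
rewrite /finite_energy /sq_summable /abs_summable /summable.
have F0 x y : 0 <= cond x y * (f x - f y) ^+ 2 by rewrite mulr_ge0 ?cond_ge0 ?sqr_ge0.
apply: le_lt_trans; rewrite le_eqVlt; apply/orP; left; apply/eqP.
transitivity (\esum_(k in [set: N] `*`` (fun=> [set: N]))
    (cond k.1 k.2 * (f k.1 - f k.2) ^+ 2)%:E).
  have -> : [set: N] `*`` (fun=> [set: N]) = [set: N * N] by apply/seteqP; split.
  by apply: eq_esum => -[x y] _ /=; rewrite ger0_norm; [|exact: F0].
rewrite -(@esum_esum _ _ _ _ _ (fun x y => (cond x y * (f x - f y) ^+ 2)%:E));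
  last by move=> x y _ _; rewrite lee_fin.
apply: eq_esum => x _ /=; have fin := adj_locally_finite x.
rewrite ger0_norm; last exact: fsumr_ge0.
rewrite (esumID [set y | adj x y]); last by move=> y _; rewrite lee_fin.
rewrite !setTI [X in (_ + X)%E]esum1 => [|y /= /negP/cond_eq0 ->]; last by rewrite mul0r.
rewrite adde0 esum_fset// => [|y _]; last by rewrite lee_fin.
by rewrite !fsbig_finite//= sumEFin.
Qed.

End unboundedness.

Lemma fsumr_subset (R : numDomainType) (I : choiceType) (A B : set I) (F : I -> R) :
  finite_set B -> A `<=` B -> (forall i, 0 <= F i) ->
  \sum_(i \in A) F i <= \sum_(i \in B) F i.
Proof.
move=> Bfin AB F0; rewrite -[in leRHS](setDUK AB) fsbigU0//.
- by rewrite lerDl fsumr_ge0.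
- exact: sub_finite_set Bfin.
- exact: finite_setD.
- by move=> y [yA [_ /(_ yA)]].
Qed.

Lemma abs_summable_nat (R : realType) (F : nat -> R) (M : R) :
  (forall n, 0 <= F n) -> (forall n, \sum_(i < n) F i <= M) -> abs_summable F.
Proof.
move=> F0 FM; have [|//] := @ssum_le _ _ F M F0 => J.
pose n := (\max_(i <- J) i).+1.
apply: le_trans (FM n); rewrite [leRHS]fsbig_ord [leLHS]fsbig_seq ?fset_uniq//.
apply: (@fsumr_subset _ _ [set` J] `I_n) => //.
move=> i /= iJ; rewrite /n ltnS; exact: (@leq_bigmax_seq _ _ xpredT id).
Qed.

Section half_line.
Context {R : realType}.

Let q n : R := 2^-1 ^+ n.

Let qS n : q n.+1 = q n / 2. Proof. by rewrite /q exprS mulrC. Qed.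
Let q0 : q 0 = 1. Proof. by rewrite /q expr0. Qed.
Let q_gt0 n : 0 < q n. Proof. by rewrite exprn_gt0// invr_gt0. Qed.
Let q_le1 n : q n <= 1. Proof. by apply: exprn_ile1; lra. Qed.

Definition half_line_adj : rel nat := fun m n => (n == m.+1) || (m == n.+1).

(** The conductance of the edge from n to n+1. It solves c (w(n+1) - w(n)) = w(0) +
... + w(n) for w(n) = 2 - 2^-n, which makes w an eigenfunction for -1. *)
Definition half_line_weight n : R := (n * 2 ^ n.+2 + 2)%:R.

Definition half_line_cond (m n : nat) : R :=
  if n == m.+1 then half_line_weight m
  else if m == n.+1 then half_line_weight n else 0.

Let weight_gt0 n : 0 < half_line_weight n.
Proof. by rewrite /half_line_weight ltr0n addn2. Qed.

Lemma half_line_adjC : symmetric half_line_adj.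
Proof. by move=> m n; rewrite /half_line_adj orbC. Qed.

Lemma half_line_adjxx : irreflexive half_line_adj.
Proof. by move=> m; rewrite /half_line_adj; apply/negbTE; lia. Qed.

Lemma half_line_connected x y : exists2 s, path half_line_adj x s & last x s = y.
Proof.
have to0 m : exists2 s, path half_line_adj m s & last m s = 0%N.
  elim: m => [|m [s ps ls]]; first by exists [::].
  by exists (m :: s) => //=; rewrite ps /half_line_adj eqxx orbT.
have from0 m : exists2 s, path half_line_adj 0%N s & last 0%N s = m.
  elim: m => [|m [s ps ls]]; first by exists [::].
  exists (rcons s m.+1); last by rewrite last_rcons.
  by rewrite rcons_path ps ls /half_line_adj eqxx.
have [s ps ls] := to0 x; have [t pt lt] := from0 y.
by exists (s ++ t); rewrite ?cat_path ?last_cat ls ?ps.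
Qed.

Lemma half_line_neighbours0 : [set y | half_line_adj 0%N y] = [set 1%N].
Proof.
by apply/seteqP; split=> y /=; rewrite /half_line_adj; lia.
Qed.

Lemma half_line_neighboursS n :
  [set y | half_line_adj n.+1 y] = [set n] `|` [set n.+2].
Proof.
apply/seteqP; split=> y /=; rewrite /half_line_adj.
  by move=> /orP[/eqP ->|/eqP[->]]; [right|left].
by move=> [->|->]; rewrite eqxx ?orbT.
Qed.

Lemma half_line_locally_finite x : finite_set [set y | half_line_adj x y].
Proof.
case: x => [|n]; first by rewrite half_line_neighbours0; exact: finite_set1.
by rewrite half_line_neighboursS finite_setU; split; exact: finite_set1.
Qed.

Lemma half_line_cond_ge0 x y : 0 <= half_line_cond x y.
Proof. by rewrite /half_line_cond; case: ifP => _; [|case: ifP => _ //]; exact: ltW. Qed.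

Lemma half_line_condC x y : half_line_cond x y = half_line_cond y x.
Proof.
rewrite /half_line_cond; have [->|] := eqVneq y x.+1; last by [].
by rewrite (_ : (x == x.+2) = false)//; lia.
Qed.

Lemma half_line_cond_gt0 x y : (0 < half_line_cond x y) = half_line_adj x y.
Proof.
rewrite /half_line_cond /half_line_adj; case: ifP => _; first exact: weight_gt0.
by case: ifP => _; [exact: weight_gt0|rewrite ltxx].
Qed.

Definition half_line : network R :=
  @Network R nat half_line_adj half_line_cond (card_eqxx _) half_line_adjC
    half_line_adjxx half_line_connected half_line_locally_finite
    half_line_cond_ge0 half_line_condC half_line_cond_gt0.

Lemma sum_half_line0 (F : nat -> R) :
  \sum_(y \in [set y | @adj R half_line 0%N y]) F y = F 1%N.
Proof. by rewrite [X in \sum_(y \in X) _]half_line_neighbours0 fsbig_set1. Qed.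

Lemma sum_half_lineS (F : nat -> R) n :
  \sum_(y \in [set y | @adj R half_line n.+1 y]) F y = F n + F n.+2.
Proof.
rewrite [X in \sum_(y \in X) _]half_line_neighboursS fsbigU0 ?fsbig_set1//.
by move=> y [/= -> ]; lia.
Qed.

Let condS n : @cond R half_line n n.+1 = half_line_weight n.
Proof. by rewrite /cond /= /half_line_cond eqxx. Qed.

Let condSl n : @cond R half_line n.+1 n = half_line_weight n.
Proof. by rewrite condC condS. Qed.

Let weight_q n : half_line_weight n * q n.+1 = 2 * n%:R + q n.
Proof.
rewrite /half_line_weight natrD natrM natrX qS !exprS.
have : 2 ^+ n * q n = 1 by rewrite /q -exprMn divff// expr1n.
by move=> e; transitivity (2 * n%:R * (2 ^+ n * q n) + q n); [field|rewrite e mulr1].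
Qed.

Definition half_line_potential (n : nat) : R := 2 - q n.

Lemma half_line_laplacian n :
  @laplacian R half_line half_line_potential n = - half_line_potential n.
Proof.
rewrite /laplacian; case: n => [|n].
  rewrite sum_half_line0 condS /half_line_potential.
  have := weight_q 0; rewrite qS q0; lra.
rewrite sum_half_lineS condS condSl /half_line_potential.
have := weight_q n; have := weight_q n.+1; rewrite !qS -[n.+1%:R]natr1; lra.
Qed.

Lemma half_line_finite_energy : @finite_energy R half_line half_line_potential.
Proof.
apply: finite_energy_local; apply: (@abs_summable_nat _ _ 6) => n.
  by apply: fsumr_ge0 => y _; apply: mulr_ge0; [exact: cond_ge0|exact: sqr_ge0].
(* t telescopes the energies of the edges: the current through the edge from k
   to k+1 is at most 2k + 1, so that its energy is at most (2k + 1) q k / 2.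
   An inner edge is counted at both of its ends. *)
pose t n : R := (2 * n%:R + 3) * q n.
have edge k : half_line_weight k * (q k.+1) ^+ 2 <= t k - t k.+1.
  rewrite expr2 mulrA weight_q /t !qS -[k.+1%:R]natr1.
  have := ler_wpM2r (ltW (q_gt0 k)) (q_le1 k); rewrite mul1r; lra.
have sq a b : (2 - a - (2 - b)) ^+ 2 = (b - a) ^+ 2 :> R by ring.
pose S k := \sum_(i < k) \sum_(y \in [set y | @adj R half_line i y])
  @cond R half_line i y * (half_line_potential i - half_line_potential y) ^+ 2.
have SS k : S k.+1 = S k + \sum_(y \in [set y | @adj R half_line k y])
    @cond R half_line k y * (half_line_potential k - half_line_potential y) ^+ 2.
  by rewrite {1}/S big_ord_recr.
have t0 k : 0 <= t k by rewrite mulr_ge0 ?ltW// addr_ge0// mulr_ge0.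
suff main k : S k.+1 + t k + t k.+1 <= 6.
  apply: (@le_trans _ _ (S n.+1)); last first.
    by have := main n; have := t0 n; have := t0 n.+1; lra.
  rewrite SS lerDl.
  by apply: fsumr_ge0 => y _; apply: mulr_ge0; [exact: cond_ge0|exact: sqr_ge0].
elim: k => [|k IH]; rewrite SS.
  rewrite {1}/S big_ord0 add0r sum_half_line0 condS /half_line_potential sq.
  have -> : half_line_weight 0 = 2 by [].
  by rewrite /t !qS q0; lra.
rewrite sum_half_lineS condS condSl /half_line_potential !sq.
have e1 : (q k - q k.+1) ^+ 2 = q k.+1 ^+ 2 by rewrite qS; congr (_ ^+ _); field.
have e2 : (q k.+2 - q k.+1) ^+ 2 = q k.+2 ^+ 2 by rewrite !qS; field.
rewrite e1 e2; have := edge k; have := edge k.+1; lra.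
Qed.

Lemma half_line_total_cond (M : R) : exists x : half_line, M < total_cond x.
Proof.
exists (Num.truncn M).+1; apply: lt_le_trans (truncnS_gt M) _.
set n := (Num.truncn M).+1.
apply: le_trans (_ : _ <= @cond R half_line n n.+1) _; last first.
  by apply: cond_le_total_cond; rewrite /adj /= /half_line_adj eqxx.
rewrite condS /half_line_weight ler_nat.
by rewrite -[leqLHS]muln1; apply: leq_trans (leq_addr _ _); rewrite leq_mul2l expn_gt0 orbT.
Qed.

End half_line.

(** * The theorem *)

Unset Implicit Arguments.

Theorem theorem4p5 (R : realType) :
  ((forall (N : network R) (o : N),
      (forall v, lspan (dipole o) v ->
         exists! w, laplacian_energy_core o (v, w)) /\
      densely_defined (laplacian_energy o) /\
      linear_operator (laplacian_energy o) /\
      nonnegative_op (laplacian_energy o) /\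
      closed (laplacian_energy o) /\
      symmetric_op (laplacian_energy o)) /\
   (exists (N : network R) (o : N),
      ~ bounded_op (laplacian_energy o) /\
      ~ self_adjoint (laplacian_energy o))) /\
  ((forall N : network R,
      linear_operator (laplacian_ell2 N) /\
      densely_defined (laplacian_ell2 N) /\
      essentially_self_adjoint (laplacian_ell2 N)) /\
   (exists N : network R, ~ bounded_op (laplacian_ell2 N))) /\
  (forall N : network R,
      dom (markov_ell2c N) = setT /\
      linear_operator (markov_ell2c N) /\
      self_adjoint (markov_ell2c N) /\
      bounded_op (markov_ell2c N) /\
      spectrum (markov_ell2c N) `<=` [set x%:C%C | x in `[-1, 1]%classic] /\
      op_le (scalar_op (-1)) (markov_ell2c N) /\
      op_le (markov_ell2c N) (scalar_op 1)).
Proof.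
split; [split|split; first split].
- move=> N o; have lin := laplacian_energy_core_linear o.
  have dns := laplacian_energy_core_dense o.
  have sym := @laplacian_energy_core_symmetric R N o.
  split.
    rewrite -dom_laplacian_energy_core => v [w vw]; exists w; split=> // w'.
    exact: laplacian_energy_core_fun vw.
  split; first exact: closure_densely_defined.
  split; first exact: closure_linear_operator.
  split; first exact/closure_nonnegative/laplacian_energy_core_nonnegative.
  split; first exact: closed_closure.
  exact: closure_symmetric.
- exists half_line, 0%N.
  apply: (@laplacian_energy_negative_eigenvector _ _ _
    (mk_fin_energy half_line_finite_energy) 0%N 1%N).
    exact: half_line_laplacian.
  by rewrite /= /half_line_potential expr0 expr1; apply/eqP; lra.
- move=> N; have [dns adj] := laplacian_ell2_self_adjoint N.
  have sym := @laplacian_ell2_core_symmetric R N.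
  split.
    apply: closure_linear_operator => //; first exact: laplacian_ell2_core_linear.
    exact: laplacian_ell2_core_dense.
  split=> //; split=> //; first exact: closure_symmetric.
  rewrite -(_ : laplacian_ell2 N = closure (laplacian_ell2 N)) //.
  by apply/closure_id; exact: closed_closure.
- exists half_line; apply: laplacian_ell2_unbounded.
  exact: half_line_total_cond.
move=> N; rewrite markov_ell2cE.
have sym := @markov_map_symmetric R N.
split; first by apply/seteqP; split=> // u _; exists (markov_map u).
split.
  split=> [|a u v u' v' uv uv'|u v v' uv uv'].
  - by apply/esym/eqP; rewrite -normr_le0 (le_trans (markov_map_norm _))//= normr0.
  - rewrite /graph /= (uv : v = markov_map u) (uv' : v' = markov_map u').
    by rewrite markov_map_linear.
  - by rewrite (uv : v = markov_map u) (uv' : v' = markov_map u).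
split; first exact: graph_self_adjoint.
split.
  exists 1 => u v uv.
  by rewrite (uv : v = markov_map u) mul1r; exact: markov_map_norm.
split.
  apply: spectrum_contraction => //; first exact: markov_map_linear.
  exact: markov_map_norm.
split=> u v w uv uw.
- rewrite (uv : v = -1 *: u) (uw : w = markov_map u) innerZl mulN1r.
  by have := markov_map_abs u; rewrite ler_norml => /andP[].
- rewrite (uv : v = markov_map u) (uw : w = 1 *: u) scale1r.
  by apply: le_trans (markov_map_abs u); exact: ler_norm.
Qed.
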